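(* Let $\mathcal{K}$ be a complex separable Hilbert space, let $N\subseteq H^2_{\mathcal{K}}$ be a model space such that $M:=H^2_{\mathcal{K}}\ominus N$ is full range, and let $W:=M\ominus S(M)$, $W_1:=W\ominus(W\cap\mathcal{K})$ and $\mathcal{K}_1:=\mathcal{K}\ominus(W\cap\mathcal{K})$. Let $\{E_j\}_{j\in J}$ be an orthonormal basis of $W_1$ and $\{e_j\}_{j\in J}$ an orthonormal basis of $\mathcal{K}_1$. Then the Parseval frames of iterations $\{A_N^n(P_Ne_j)\}_{j\in J,\,n\geqslant0}$ (of the operator $A_N$) and $\{(S^* )^nS^*E_j\}_{j\in J,\,n\geqslant0}$ (of the operator $S^*|_N$) of $N$ are optimal.
   Context: Let $\mathbb{T}$ be the unit circle with normalized Lebesgue measure. $H^2_{\mathcal{K}}\subseteq L^2(\mathbb{T},\mathcal{K})$ is the Hardy space of square-integrable $\mathcal{K}$-valued functions on $\mathbb{T}$ whose Fourier coefficients of negative index vanish; $\mathcal{K}$ is identified with the subspace of constant functions in $H^2_{\mathcal{K}}$. $S:H^2_{\mathcal{K}}\to H^2_{\mathcal{K}}$, $Sf(z)=zf(z)$, is the unilateral shift, with adjoint $S^*f(z)=(f(z)-f(0))/z$. A model space is a closed $S^*$-invariant subspace $N\subseteq H^2_{\mathcal{K}}$; $A_N:N\to N$, $A_Nf=P_NSf$, is the shift compression, with $P_N$ the orthogonal projection onto $N$. For a closed $S$-invariant subspace $M\subseteq H^2_{\mathcal{K}}$ and an orthonormal basis $\{F_i\}_i$ of $W=M\ominus S(M)$,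 set $J(z)=\overline{\mathrm{span}}\{F_i(z)\}_i\subseteq\mathcal{K}$ for almost every $z\in\mathbb{T}$ (independent of the basis, up to null sets). $M$ is full range if $J(z)=\mathcal{K}$ for almost every $z$. Under the assumptions of the claim $\dim W_1=\dim\mathcal{K}_1$, so the two orthonormal bases may be indexed by the same set $J$, and both systems in the claim are Parseval frames of $N$ (a countable family $\{x_k\}_k$ is a Parseval frame of $N$ if $\sum_k|\langle x,x_k\rangle|^2=\|x\|^2$ for all $x\in N$). For a bounded operator $T$ on a Hilbert space $\mathcal{H}$, an at most countable family of non-zero vectors $\{v_i\}_{i\in I}$ is a set of Parseval generators for $T$ if $\{T^nv_i\}_{i\in I,n\geqslant0}$ is a Parseval frame of $\mathcal{H}$. The Parseval frame index $\gamma_p(T)$ is the minimal $d\in\mathbb{N}$ such that there is a set of $d$ Parseval generators for $T$, if a finite such set exists; $\gamma_p(T)=0$ if there is no set of Parseval generators; $\gamma_p(T)=+\infty$ if there are sets of Parseval generators but no finite ones. A Parseval frame of iterations $\{T^nv_i\}_{i\in I,n\geqslant0}$ is optimal if $\{v_i\}_{i\in I}$ is a linearly independent set of (non-zero) Parseval generators and $\#I=\gamma_p(T)$ (where $+\infty$ means countably infinite). *)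

(* Defs.v *)
From HB Require Import structures.
From mathcomp Require Import all_boot all_order all_algebra sesquilinear.
From mathcomp Require Import complex.
From mathcomp Require Import all_classical all_reals all_analysis.
From mathcomp Require Import measurable_realfun.
From mathcomp Require Import ring lra.

(* Written with MathComp and MathComp-Analysis. Inner products are linear in
   their first argument; norms over R[i] take values in R[i]. *)

Set Implicit Arguments.
Unset Strict Implicit.
Unset Printing Implicit Defensive.

Import Order.TTheory GRing.Theory Num.Theory.
Import numFieldNormedType.Exports.

Local Open Scope classical_set_scope.
Local Open Scope ring_scope.

HB.mixin Record NormedModule_hasInner (R : realType) V & NormedModule R[i] V := {
  inner : {dot V for @Num.conj R[i]};
  inner_norm : forall u, inner u u = `|u| ^+ 2 }.

#[short(type="innerType")]
HB.structure Definition InnerSpace (R : realType) :=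
  {V of NormedModule_hasInner R V & NormedModule R[i] V}.

HB.mixin Record isSeparable V & Topological V := {
  separable : exists2 D : set V, countable D & dense D }.

#[short(type="sepHilbertType")]
HB.structure Definition SepHilbert (R : realType) :=
  {V of InnerSpace R V & Complete V & isSeparable V}.

Notation "''[' u , v ]" := (inner u%R v%R) : ring_scope.

HB.factory Record Lmodule_hasInner (R : realType) V & GRing.Lmodule R[i] V := {
  form : {dot V for @Num.conj R[i]} }.

HB.builders Context R V & Lmodule_hasInner R V.

Let CauchySchwarz (u v : V) : `|form u v| <= sqrtC (form u u) * sqrtC (form v v).
Proof.
rewrite -ler_sqr ?nnegrE ?mulr_ge0 ?sqrtC_ge0 ?dnorm_ge0// exprMn !sqrtCK.
have [->|v0] := eqVneq v 0; first by rewrite !linear0r normr0 expr0n lexx.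
have vp : 0 < form v v by exact: neq0_dnorm_gt0.
pose a := form u v / form v v; pose w := u - a *: v.
have wv : form w v = 0 by rewrite linearBl/= linearZl_LR/= divfK ?gt_eqF ?subrr.
have uE : form u u = form w w + `|a| ^+ 2 * form v v.
  have -> : form u u = form (w + a *: v) (w + a *: v) by rewrite subrK.
  rewrite hnormDd; last by rewrite linearZr_LR /= wv mulr0.
  by rewrite linearZl_LR linearZr_LR/= mulrA -normCK.
have -> : `|form u v| ^+ 2 = `|a| ^+ 2 * form v v * form v v.
  rewrite /a normrM normfV (gtr0_norm vp) exprMn exprVn -mulrA -expr2.
  by rewrite divfK// expf_eq0/= gt_eqF.
by rewrite uE mulrDl lerDr mulr_ge0 ?dnorm_ge0.
Qed.

Let norm (u : V) := sqrtC (form u u).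

Let ler_normD u v : norm (u + v) <= norm u + norm v.
Proof.
rewrite -ler_sqr ?nnegrE ?addr_ge0 ?sqrtC_ge0 ?dnorm_ge0// sqrrD !sqrtCK.
rewrite hnormD /= expr0 mul1r addrAC lerD2r lerD2l.
have -> : form u v + (form u v)^* = 'Re (form u v) *+ 2.
  by rewrite ReE -mulr_natr divfK ?pnatr_eq0.
rewrite lerMn2r/=; apply: le_trans (CauchySchwarz u v).
by have [] := leif_Re_Creal (form u v).
Qed.

Let normrZ (l : R[i]) (u : V) : norm (l *: u) = `|l| * norm u.
Proof.
rewrite /norm linearZl_LR linearZr_LR/= mulrA -normCK sqrtCM ?nnegrE ?dnorm_ge0//.
  by rewrite sqrCK.
Qed.

Let normr0_eq0 u : norm u = 0 -> u = 0.
Proof. by move=> /eqP; rewrite sqrtC_eq0 dnorm_eq0 => /eqP. Qed.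

HB.instance Definition _ :=
  Lmodule_isNormed.Build R[i] V ler_normD normrZ normr0_eq0.

Let inner_norm (u : V) : form u u = `|u| ^+ 2.
Proof. by rewrite sqrtCK. Qed.

HB.instance Definition _ := NormedModule_hasInner.Build R V inner_norm.

HB.end.

Definition borel_fun d (T : measurableType d) (X : ptopologicalType)
    (f : T -> X) :=
  measurable_fun setT (f : T -> g_sigma_algebraType (@open X)).

Section borel_fun.
Context d (T : measurableType d).

Let countable_bigcup_measurable (U : Type) (I : set U) (F : U -> set T) :
  countable I -> (forall i, I i -> measurable (F i)) ->
  measurable (\bigcup_(i in I) F i).
Proof.
move=> /countable_injP[f finj] mF.
have -> : \bigcup_(i in I) F i = \bigcup_(i : I) F (val i).
  apply/seteqP; split=> [x [i Ii Fix]|x [[i Ii] _ Fix]]; last first.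
    by exists i => //; exact: set_mem Ii.
  by exists (SigSub (mem_set Ii)).
apply: countable_bigcupT_measurable; last by case=> i Ii; exact/mF/(set_mem Ii).
apply/countable_injP; exists (f \o val) => -[i Ii] [j Ij] _ _ /= fij.
by apply/val_inj/finj.
Qed.

Lemma borel_funP (X : ptopologicalType) (f : T -> X) :
  borel_fun f <-> forall U, open U -> measurable (f @^-1` U).
Proof.
split=> [mf U oU|mf].
  by rewrite -[X in measurable X]setTI; apply: mf => //; exact: sub_gen_smallest.
apply: (@measurability _ _ _ (g_sigma_algebraType (@open X)) _ _ (@open X)) => //.
by move=> _ [U oU <-]; rewrite setTI; exact: mf.
Qed.

Lemma borel_fun_continuous (X Y : ptopologicalType) (h : X -> Y) (f : T -> X) :
  continuous h -> borel_fun f -> borel_fun (h \o f).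
Proof.
move=> /continuousP ch /borel_funP mf; apply/borel_funP => U oU.
by rewrite comp_preimage; apply: mf; exact: ch.
Qed.

Lemma borel_fun_continuous2 (X Y Z : ptopologicalType) (h : X * Y -> Z)
    (f : T -> X) (g : T -> Y) :
  @second_countable X -> @second_countable Y -> continuous h ->
  borel_fun f -> borel_fun g -> borel_fun (fun x => h (f x, g x)).
Proof.
move=> [A cA [oA bA]] [B cB [oB bB]] ch /borel_funP mf /borel_funP mg.
apply/borel_funP => U oU.
pose I := [set ab : set X * set Y |
  [/\ A ab.1, B ab.2 & ab.1 `*` ab.2 `<=` h @^-1` U]].
have -> : (fun x => h (f x, g x)) @^-1` U =
    \bigcup_(ab in I) (f @^-1` ab.1 `&` g @^-1` ab.2).
  apply/seteqP; split=> [x /= Ux|x [[a b] [/= Aa Bb abU] [fa gb]]]; last first.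
    by apply: (abU (f x, g x)).
  have : nbhs (f x, g x) (h @^-1` U).
    by apply: ch; exact: open_nbhs_nbhs.
  case=> -[/= P Q] [nP nQ] PQU.
  have [a [Aa afx] aP] := bA _ _ nP.
  have [b [Bb bgx] bQ] := bB _ _ nQ.
  exists (a, b) => //; split => //= -[u v] [/= ua vb].
  by apply: PQU; split => /=; [exact: aP|exact: bQ].
apply: countable_bigcup_measurable.
  by apply: sub_countable (countableX cA cB); apply: subset_card_le => ab [].
by move=> -[a b] [Aa Bb _]; apply: measurableI; [exact/mf/oA|exact/mg/oB].
Qed.

Lemma borel_fun_realP (R : realType) (f : T -> R) :
  borel_fun f <-> measurable_fun setT f.
Proof.
split=> [/borel_funP mf|mf]; last first.
  apply/borel_funP => U oU; rewrite -[X in measurable X]setTI.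
  by apply: mf => //; exact: open_measurable.
apply: (measurability _ (RGenOpens.measurableE R)).
move=> _ [_ [a [b ->]] <-]; rewrite setTI.
by apply: mf; exact: interval_open.
Qed.

End borel_fun.

Lemma second_countable_dense (R : realType) (V : normedModType R[i])
    (D : set V) : countable D -> dense D -> @second_countable V.
Proof.
move=> cD dD.
exists [set U | exists n x, D x /\ U = ball x (n.+1%:R^-1)].
  have -> : [set U | exists n x, D x /\ U = ball x (n.+1%:R^-1)] =
     (fun nx : nat * V => ball nx.2 (nx.1.+1%:R^-1)) @` (setT `*` D).
    apply/seteqP; split=> [_ [n [x [Dx ->]]]|_ [[n x] [/= _ Dx] <-]].
      by exists (n, x).
    by exists n, x.
  apply: sub_countable (card_image_le _ _) _; exact: countableX.
split=> [_ [n [x [Dx ->]]]|x U /nbhs_ballP[e e0 eU]].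
  by apply: ball_open; rewrite invr_gt0.
have e20 : 0 < e / 2 by rewrite divr_gt0.
have [n ne] : exists n, n.+1%:R^-1 < e / 2.
  have := e20; rewrite -(RRe_real (gtr0_real e20)) ltcR => re0.
  have [n] := ltr_add_invr re0; rewrite add0r => ne.
  by exists n; rewrite -(rmorph_nat (real_complex R)) -fmorphV ltcR.
have [||y [xy Dy]] := dD (ball x (n.+1%:R^-1)).
- by exists x; apply: ballxx; rewrite invr_gt0.
- by apply: ball_open; rewrite invr_gt0.
exists (ball y n.+1%:R^-1); first split.
- by exists n, y.
- exact: ball_sym.
move=> z yz; apply: eU; rewrite [e]splitr.
by apply: (@ball_triangle _ _ y); apply: le_ball (ltW ne) _ _.
Qed.

Lemma second_countable_real (R : realType) : @second_countable R.
Proof.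
exists [set U | exists n (q : rat), U = ball (ratr q : R) (n.+1%:R^-1)].
  have -> : [set U | exists n (q : rat), U = ball (ratr q : R) (n.+1%:R^-1)] =
     (fun nx : nat * rat => ball (ratr nx.2 : R) (nx.1.+1%:R^-1)) @` setT.
    apply/seteqP; split=> [_ [n [x ->]]|_ [[n x] _ <-]].
      by exists (n, x).
    by exists n, x.
  apply: sub_countable (card_image_le _ _) _; exact: countableP.
split=> [_ [n [x ->]]|x U /nbhs_ballP[e /= e0 eU]].
  by apply: ball_open; rewrite invr_gt0.
have e20 : 0 < e / 2 by rewrite divr_gt0.
have [n] := @ltr_add_invr R 0 _ e20; rewrite add0r => ne.
have [||y [xy [q _ qE]]] := @dense_rat R (ball x (n.+1%:R^-1)).
- by exists x; apply: ballxx; rewrite invr_gt0.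
- by apply: ball_open; rewrite invr_gt0.
exists (ball y n.+1%:R^-1); first split.
- by exists n, q; rewrite qE.
- exact: ball_sym.
move=> z yz; apply: eU; rewrite [e]splitr.
by apply: (@ball_triangle _ _ y); apply: le_ball (ltW ne) _ _.
Qed.

Section inner_theory.
Context {R : realType} {V : innerType R}.
Implicit Types u v : V.

Lemma inner_conj u v : '[u, v] = ('[v, u])^*%C.
Proof. by rewrite hermC expr0 mul1r. Qed.

Definition sqnorm u : R := complex.Re (`|u| ^+ 2).

Lemma sqnormE u : sqnorm u = complex.Re '[u, u].
Proof. by rewrite inner_norm. Qed.

Lemma sqnorm_ge0 u : 0 <= sqnorm u.
Proof.
by rewrite -lecR RRe_real ?exprn_ge0// ger0_real ?exprn_ge0.
Qed.

Lemma sqnorm_eq0 u : sqnorm u = 0 -> u = 0.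
Proof.
move=> u0; apply/eqP; rewrite -normr_eq0 -sqrf_eq0.
rewrite -[_ ^+ 2]RRe_real; first by rewrite -/(sqnorm u) u0.
by rewrite ger0_real ?exprn_ge0.
Qed.

Lemma sqnormD u v :
  sqnorm (u + v) = sqnorm u + sqnorm v + complex.Re '[u, v] *+ 2.
Proof.
rewrite !sqnormE linearDl/= !linearDr/= (inner_conj v u) !raddfD/=.
by case: '[u, v] => a b /=; rewrite mulr2n; ring.
Qed.

Lemma sqnormN u : sqnorm (- u) = sqnorm u.
Proof. by rewrite /sqnorm normrN. Qed.

Lemma sqnormB u v :
  sqnorm (u - v) = sqnorm u + sqnorm v - complex.Re '[u, v] *+ 2.
Proof. by rewrite sqnormD sqnormN linearNr raddfN/= mulNrn. Qed.

Lemma sqnormZ (c : R[i]) u : sqnorm (c *: u) = complex.Re (`|c| ^+ 2) * sqnorm u.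
Proof.
rewrite /sqnorm normrZ exprMn.
have /complex_realP[a ->] : `|c| ^+ 2 \is Num.real by rewrite ger0_real ?exprn_ge0.
have /complex_realP[b ->] : `|u| ^+ 2 \is Num.real by rewrite ger0_real ?exprn_ge0.
by rewrite /= mulr0 subr0.
Qed.

Lemma le_sqnormD u v : sqnorm (u + v) <= 2 * (sqnorm u + sqnorm v).
Proof.
have := sqnorm_ge0 (u - v); rewrite sqnormB sqnormD.
by rewrite mulr2n; lra.
Qed.

Lemma le_Re_inner u v : `|complex.Re '[u, v]| <= sqnorm u + sqnorm v.
Proof.
have := sqnorm_ge0 (u - v); have := sqnorm_ge0 (u + v).
rewrite sqnormB sqnormD mulr2n ler_norml.
have := sqnorm_ge0 u; have := sqnorm_ge0 v.
by move=> *; apply/andP; split; lra.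
Qed.

Lemma Im_inner u v : complex.Im '[u, v] = complex.Re '[u, 'i%C *: v].
Proof. by rewrite linearZr_LR/=; case: '[u, v] => a b /=; ring. Qed.

Lemma sqnormi u : sqnorm ('i%C *: u) = sqnorm u.
Proof. by rewrite sqnormZ sqr_normc/= !mul0r sub0r mulrN opprK mulr1 mul1r. Qed.

Lemma Re_inner_polar u v :
  complex.Re '[u, v] = (sqnorm (u + v) - sqnorm (u - v)) / 4.
Proof. by rewrite sqnormB sqnormD !mulr2n; field. Qed.

Lemma sqnorm_continuous : continuous (sqnorm : V -> R).
Proof.
have cn : continuous (fun u : V => complex.Re `|u|).
  move=> u; apply/cvgrPdist_lt => e e0; near=> v.
  rewrite -ltcR (le_lt_trans (y := `|u - v|))//; last first.
    by near: v; apply: cvgr_dist_lt => //; rewrite ltcR.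
  rewrite -raddfB; apply: (le_trans (normc_ge_Re _)).
  exact: ler_dist_dist.
have -> : sqnorm = (fun u => complex.Re `|u| ^+ 2).
  apply/funext => u; rewrite /sqnorm.
  have /complex_realP[a ->] : `|u| \is Num.real by rewrite ger0_real.
  by rewrite -rmorphXn.
move=> u; apply: (@continuous_comp _ _ _ (fun u => complex.Re `|u|) (fun x => x ^+ 2)).
  exact: cn.
exact: exprn_continuous.
Unshelve. all: by end_near. Qed.

End inner_theory.

Section sepHilbert_borel.
Context d (T : measurableType d) (R : realType) (K : sepHilbertType R).
Implicit Types f g : T -> K.

Lemma sepHilbert_second_countable : @second_countable K.
Proof.
by have [D] := @separable R K; exact: second_countable_dense.
Qed.

Lemma borel_funD f g : borel_fun f -> borel_fun g -> borel_fun (f \+ g).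
Proof.
apply: (@borel_fun_continuous2 _ _ _ _ _ (fun p : K * K => p.1 + p.2)).
- exact: sepHilbert_second_countable.
- exact: sepHilbert_second_countable.
- exact: add_continuous.
Qed.

Lemma borel_funZ (c : R[i]) f : borel_fun f -> borel_fun (c \*: f).
Proof. by apply: borel_fun_continuous; exact: scaler_continuous. Qed.

Lemma borel_fun_cst (u : K) : borel_fun (fun _ : T => u).
Proof. exact: measurable_cst. Qed.

Lemma borel_fun_sqnorm f : borel_fun f -> measurable_fun setT (sqnorm \o f).
Proof.
by move=> mf; apply/borel_fun_realP; apply: borel_fun_continuous mf; exact: sqnorm_continuous.
Qed.

Lemma borel_fun_Re_inner f g : borel_fun f -> borel_fun g ->
  measurable_fun setT (fun x => complex.Re '[f x, g x]).
Proof.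
move=> mf mg; under eq_fun do rewrite Re_inner_polar.
apply: measurable_funM => //; apply: measurable_funB.
  by apply: (@borel_fun_sqnorm (f \+ g)); exact: borel_funD.
apply: (@borel_fun_sqnorm (fun x => f x - g x)).
apply: borel_funD => //.
have -> : (fun x => - g x) = (-1) \*: g by apply/funext => x /=; rewrite scaleN1r.
exact: borel_funZ.
Qed.

Lemma borel_fun_Im_inner f g : borel_fun f -> borel_fun g ->
  measurable_fun setT (fun x => complex.Im '[f x, g x]).
Proof.
move=> mf mg; under eq_fun do rewrite Im_inner.
by apply: (@borel_fun_Re_inner f ('i%C \*: g)) => //; exact: borel_funZ.
Qed.

Lemma borel_fun_realZ (a : T -> R) f :
  measurable_fun setT a -> borel_fun f -> borel_fun (fun x => (a x)%:C%C *: f x).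
Proof.
move=> /borel_fun_realP.
apply: (@borel_fun_continuous2 _ _ _ _ _ (fun p : R * K => p.1%:C%C *: p.2)).
- exact: second_countable_real.
- exact: sepHilbert_second_countable.
move=> p; apply: (@cvgZ R[i] K).
  apply/cvgrPdist_lt => e e0; near=> q.
  have : `|p.1 - q.1| < complex.Re e.
    near: q. apply: (@cvgr_dist_lt _ _ _ _ _ fst) => //.
      exact: cvg_fst.
    by move: e0; rewrite ltcE => /andP[].
  rewrite -ltcR RRe_real ?gtr0_real// -rmorphB/=.
  by rewrite normc_def/= expr0n addr0 sqrtr_sqr.
exact: cvg_snd.
Unshelve. all: by end_near. Qed.

Lemma borel_fun_complexZ (c : T -> R[i]) f :
  measurable_fun setT (fun x => complex.Re (c x)) ->
  measurable_fun setT (fun x => complex.Im (c x)) ->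
  borel_fun f -> borel_fun (fun x => c x *: f x).
Proof.
move=> mr mi mf.
have -> : (fun x => c x *: f x) = (fun x => (complex.Re (c x))%:C%C *: f x) \+
    'i%C \*: (fun x => (complex.Im (c x))%:C%C *: f x).
  by apply/funext => x /=; rewrite {1}[c x]complexE scalerDl scalerA.
by apply: borel_funD; [|apply: borel_funZ]; exact: borel_fun_realZ.
Qed.

End sepHilbert_borel.

Section complex_integral.
Context d (T : measurableType d) (R : realType) (mu : {measure set T -> \bar R}).

Definition Cintegral (f : T -> R[i]) : R[i] :=
  ((\int[mu]_x complex.Re (f x)) +i* (\int[mu]_x complex.Im (f x)))%C.

End complex_integral.

Section L2fun.
Context d (T : measurableType d) (R : realType) (mu : {measure set T -> \bar R})
  (K : sepHilbertType R).
Implicit Types f g : T -> K.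

(* K is separable, so Borel and strong (Bochner) measurability coincide. *)
Definition L2_pred : {pred T -> K} := fun f =>
  `[< borel_fun f /\ (\int[mu]_x (sqnorm (f x))%:E < +oo)%E >].

Lemma L2_predP f :
  reflect (borel_fun f /\ (\int[mu]_x (sqnorm (f x))%:E < +oo)%E) (f \in L2_pred).
Proof. exact: asboolP. Qed.

Lemma sqnorm_integrable f : f \in L2_pred ->
  mu.-integrable setT (EFin \o (sqnorm \o f)).
Proof.
move=> /L2_predP[mf foo]; apply/integrableP; split.
  by apply/measurable_EFinP; exact: borel_fun_sqnorm.
by under eq_integral do rewrite /= ger0_norm ?sqnorm_ge0//.
Qed.

Lemma L2_submod : submod_closed L2_pred.
Proof.
split.
  apply/L2_predP; split; first exact: borel_fun_cst.
  under eq_integral do rewrite /sqnorm normr0 expr0n/=.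
  by rewrite integral0.
move=> c f g fL gL; apply/L2_predP.
have [mf _] := L2_predP _ fL; have [mg _] := L2_predP _ gL.
have mh : borel_fun (c *: f + g) by apply: borel_funD => //; exact: borel_funZ.
split=> //.
pose b := 2 * complex.Re (`|c| ^+ 2).
have hi : mu.-integrable setT
    (EFin \o (fun x => b * sqnorm (f x) + 2 * sqnorm (g x))).
  rewrite (_ : _ \o _ = (fun x => (b%:E * (sqnorm (f x))%:E + 2%:E * (sqnorm (g x))%:E)%E))//.
  by apply: integrableD => //; apply: integrableZl => //; exact: sqnorm_integrable.
apply: le_lt_trans (integrableP _ _ _ hi).2.
apply: ge0_le_integral => //.
- by move=> x _; rewrite lee_fin sqnorm_ge0.
- by apply/measurable_EFinP; exact: borel_fun_sqnorm mh.
- by apply: measurableT_comp => //; exact: (integrableP _ _ _ hi).1.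
move=> x _ /=; rewrite lee_fin (le_trans _ (ler_norm _))//.
apply: (le_trans (le_sqnormD (c *: f x) (g x))).
by rewrite sqnormZ mulrDr mulrA.
Qed.

HB.instance Definition _ := GRing.isSubmodClosed.Build R[i] (T -> K) L2_pred L2_submod.

Definition L2fun := {f : T -> K | f \in L2_pred}.
HB.instance Definition _ := SubChoice.on L2fun.
HB.instance Definition _ := [SubChoice_isSubLmodule of L2fun by <:].

End L2fun.

Arguments L2_pred {d T R} mu K.

Section L2.
Context d (T : measurableType d) (R : realType) (mu : {measure set T -> \bar R})
  (K : sepHilbertType R).

Definition L2_null : {pred L2fun mu K} := fun f =>
  `[< {ae mu, forall x, val f x = 0} >].

Lemma L2_null_zmod : zmod_closed L2_null.
Proof.
split; first by apply/asboolP; apply: aeW => x.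
move=> f g /asboolP fN /asboolP gN; apply/asboolP.
by apply: filterS2 (fN) (gN) => x /= fx gx; rewrite !fctE fx gx subrr.
Qed.

HB.instance Definition _ :=
  GRing.isZmodClosed.Build (L2fun mu K) L2_null L2_null_zmod.

Definition L2 := Quotient.quot L2_null.
HB.instance Definition _ := GRing.Zmodule.on L2.

Definition L2_class (f : L2fun mu K) : L2 := (\pi_(Quotient.quot L2_null) f)%qT.
Definition mkL2 (f : T -> K) (fL : f \in L2_pred mu K) : L2 :=
  L2_class (exist _ f fL).
Definition L2_eval (F : L2) : T -> K := val (repr (F : Quotient.quot L2_null)).

Lemma L2_classP f g :
  L2_class f = L2_class g <-> {ae mu, forall x, val f x = val g x}.
Proof.
split.
  move=> /eqP; rewrite -Quotient.idealrBE => /asboolP fg.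
  by apply: filterS (fg) => x /= /eqP; rewrite !fctE subr_eq0 => /eqP.
move=> fg; apply/eqP; rewrite -Quotient.idealrBE; apply/asboolP.
by apply: filterS (fg) => x /= fgx; rewrite !fctE fgx subrr.
Qed.

Lemma L2_classK F : L2_class (repr (F : Quotient.quot L2_null)) = F.
Proof. exact: reprK. Qed.

Lemma L2_eval_class f : {ae mu, forall x, L2_eval (L2_class f) x = val f x}.
Proof. by apply/L2_classP; rewrite L2_classK. Qed.

Lemma L2_eval_mkL2 f (fL : f \in L2_pred mu K) :
  {ae mu, forall x, L2_eval (mkL2 fL) x = f x}.
Proof. exact: L2_eval_class. Qed.

Lemma L2_eval_inj F G :
  {ae mu, forall x, L2_eval F x = L2_eval G x} -> F = G.
Proof. by move=> FG; rewrite -(L2_classK F) -(L2_classK G); apply/L2_classP. Qed.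

Lemma L2_classD f g : L2_class (f + g) = L2_class f + L2_class g.
Proof. exact: Quotient.pi_add. Qed.

Definition L2_scale (c : R[i]) (F : L2) : L2 :=
  L2_class (c *: repr (F : Quotient.quot L2_null)).

Lemma L2_scale_class c f : L2_scale c (L2_class f) = L2_class (c *: f).
Proof.
apply/L2_classP; apply: filterS (L2_eval_class f) => x fx /=.
by rewrite !fctE; congr (_ *: _).
Qed.

Let L2_scaleA a b F : L2_scale a (L2_scale b F) = L2_scale (a * b) F.
Proof. by rewrite -(L2_classK F) !L2_scale_class scalerA. Qed.

Let L2_scale1 : left_id 1 L2_scale.
Proof. by move=> F; rewrite -(L2_classK F) L2_scale_class scale1r. Qed.

Let L2_scaleDr : right_distributive L2_scale +%R.
Proof.
move=> c F G; rewrite -(L2_classK F) -(L2_classK G).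
by rewrite -L2_classD !L2_scale_class scalerDr L2_classD.
Qed.

Let L2_scaleDl F : {morph L2_scale^~ F : a b / a + b}.
Proof.
by move=> a b; rewrite -(L2_classK F) !L2_scale_class scalerDl L2_classD.
Qed.

HB.instance Definition _ := GRing.Zmodule_isLmodule.Build R[i] L2
  L2_scaleA L2_scale1 L2_scaleDr L2_scaleDl.

Lemma L2_evalD F G :
  {ae mu, forall x, L2_eval (F + G) x = L2_eval F x + L2_eval G x}.
Proof.
rewrite -(L2_classK F) -(L2_classK G) -L2_classD.
apply: filterS3 (L2_eval_class (repr F)) (L2_eval_class (repr G)) (L2_eval_class (repr F + repr G)) => x Fx Gx ->.
by rewrite Fx Gx.
Qed.

Lemma L2_evalZ c F : {ae mu, forall x, L2_eval (c *: F) x = c *: L2_eval F x}.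
Proof.
rewrite -(L2_classK F) [_ *: _]L2_scale_class.
apply: filterS2 (L2_eval_class (repr F)) (L2_eval_class (c *: repr F)) => x Fx ->.
by rewrite Fx.
Qed.

Lemma L2_class0 : L2_class 0 = 0.
Proof. by apply: (addrI (L2_class 0)); rewrite -L2_classD !addr0. Qed.

Lemma L2_eval0 : {ae mu, forall x, L2_eval 0 x = 0}.
Proof. by rewrite -L2_class0; exact: L2_eval_class. Qed.

Lemma L2_evalP F : L2_eval F \in L2_pred mu K.
Proof. exact: valP. Qed.

Lemma borel_fun_L2_eval F : borel_fun (L2_eval F).
Proof. by have /L2_predP[] := L2_evalP F. Qed.

Lemma integrable_Re_inner F G :
  mu.-integrable setT (fun x => (complex.Re '[L2_eval F x, L2_eval G x])%:E).
Proof.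
have FGi : mu.-integrable setT
    (fun x => (sqnorm (L2_eval F x) + sqnorm (L2_eval G x))%:E).
  have Fi := sqnorm_integrable (L2_evalP F).
  have Gi := sqnorm_integrable (L2_evalP G).
  have := @integrableD _ _ _ mu _ measurableT _ _ Fi Gi.
  by apply: eq_integrable.
apply: le_integrable FGi => //.
  by apply/measurable_EFinP/borel_fun_Re_inner; exact: borel_fun_L2_eval.
move=> x _; rewrite lee_fin [leRHS]ger0_norm ?addr_ge0 ?sqnorm_ge0//.
exact: le_Re_inner.
Qed.

Lemma integrable_Im_inner F G :
  mu.-integrable setT (fun x => (complex.Im '[L2_eval F x, L2_eval G x])%:E).
Proof.
have FGi : mu.-integrable setT
    (fun x => (sqnorm (L2_eval F x) + sqnorm (L2_eval G x))%:E).
  have Fi := sqnorm_integrable (L2_evalP F).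
  have Gi := sqnorm_integrable (L2_evalP G).
  have := @integrableD _ _ _ mu _ measurableT _ _ Fi Gi.
  by apply: eq_integrable.
apply: le_integrable FGi => //.
  by apply/measurable_EFinP/borel_fun_Im_inner; exact: borel_fun_L2_eval.
move=> x _; rewrite lee_fin [leRHS]ger0_norm ?addr_ge0 ?sqnorm_ge0//.
by rewrite Im_inner (le_trans (le_Re_inner _ _))// sqnormi.
Qed.

Definition L2_inner F G : R[i] :=
  Cintegral mu (fun x => '[L2_eval F x, L2_eval G x]).

Let L2_innerC F G : L2_inner F G = (-1) ^+ false * (L2_inner G F)^*%R.
Proof.
rewrite expr0 mul1r /L2_inner /Cintegral; congr (_ +i* _)%C.
  by apply: eq_Rintegral => x _; rewrite inner_conj; case: '[_, _].
rewrite -mulN1r -RintegralZl//; last exact: integrable_Im_inner.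
by apply: eq_Rintegral => x _; rewrite inner_conj mulN1r; case: '[_, _].
Qed.

Let ae_Rintegral (f g : T -> R) :
  measurable_fun setT f -> measurable_fun setT g ->
  {ae mu, forall x, f x = g x} ->
  \int[mu]_x f x = \int[mu]_x g x.
Proof.
move=> mf mg fg; congr fine; apply: ae_eq_integral => //.
- exact/measurable_EFinP.
- exact/measurable_EFinP.
- by apply: filterS fg => x /= ->.
Qed.

Let L2_inner_linearl c F G H :
  L2_inner (c *: F + G) H = c * L2_inner F H + L2_inner G H.
Proof.
have FGE : {ae mu, forall x, '[L2_eval (c *: F + G) x, L2_eval H x] =
    c * '[L2_eval F x, L2_eval H x] + '[L2_eval G x, L2_eval H x]}.
  apply: filterS2 (L2_evalD (c *: F) G) (L2_evalZ c F) => x -> ->.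
  by rewrite linearDl/= linearZl_LR.
have iFr := integrable_Re_inner F H; have iFi := integrable_Im_inner F H.
have iGr := integrable_Re_inner G H; have iGi := integrable_Im_inner G H.
have rE (a z w : R[i]) : complex.Re (a * z + w) =
    (complex.Re a * complex.Re z - complex.Im a * complex.Im z) + complex.Re w.
  by case: a z w => ? ? [? ?] [? ?].
have iE (a z w : R[i]) : complex.Im (a * z + w) =
    (complex.Re a * complex.Im z + complex.Im a * complex.Re z) + complex.Im w.
  by case: a z w => ? ? [? ?] [? ?].
have iZ (a : R) f : mu.-integrable setT (EFin \o f) ->
    mu.-integrable setT (EFin \o (fun x => a * f x)).
  by move=> fi; have := integrableZl measurableT a fi.
have iD (f g : T -> R) : mu.-integrable setT (EFin \o f) ->
    mu.-integrable setT (EFin \o g) ->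
    mu.-integrable setT (EFin \o (fun x => f x + g x)).
  by move=> fi gi; have := integrableD measurableT fi gi.
have iB (f g : T -> R) : mu.-integrable setT (EFin \o f) ->
    mu.-integrable setT (EFin \o g) ->
    mu.-integrable setT (EFin \o (fun x => f x - g x)).
  by move=> fi gi; have := integrableB measurableT fi gi.
have mi (f : T -> R) : mu.-integrable setT (EFin \o f) -> measurable_fun setT f.
  by move=> /measurable_int/measurable_EFinP.
apply/eqP; rewrite eq_complex rE iE /L2_inner /Cintegral /=.
apply/andP; split; apply/eqP.
  rewrite (@ae_Rintegral _ (fun x =>
    (complex.Re c * complex.Re '[L2_eval F x, L2_eval H x] -
     complex.Im c * complex.Im '[L2_eval F x, L2_eval H x]) +
     complex.Re '[L2_eval G x, L2_eval H x])).
  - rewrite RintegralD//; last by apply: iB; exact: iZ.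
    by rewrite RintegralB ?RintegralZl//; exact: iZ.
  - by apply: mi; exact: integrable_Re_inner.
  - by apply: mi; apply: iD => //; apply: iB; exact: iZ.
  - by apply: filterS FGE => x ->; exact: rE.
rewrite (@ae_Rintegral _ (fun x =>
  (complex.Re c * complex.Im '[L2_eval F x, L2_eval H x] +
   complex.Im c * complex.Re '[L2_eval F x, L2_eval H x]) +
   complex.Im '[L2_eval G x, L2_eval H x])).
- rewrite RintegralD//; last by apply: iD; exact: iZ.
  by rewrite RintegralD ?RintegralZl//; exact: iZ.
- by apply: mi; exact: integrable_Im_inner.
- by apply: mi; apply: (iD) => //; apply: iD; exact: iZ.
- by apply: filterS FGE => x ->; exact: iE.
Qed.

Let L2_inner_bilinear : bilinear_for
  (GRing.Scale.Law.clone _ _ ( *%R) _)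
  (GRing.Scale.Law.clone _ _ (@Num.conj R[i] \; *%R) _) L2_inner.
Proof.
split=> [H|H] c F G /=; first exact: L2_inner_linearl.
rewrite L2_innerC L2_inner_linearl !expr0 !mul1r rmorphD rmorphM/=.
by rewrite [in RHS]L2_innerC [X in _ = _ + X]L2_innerC !expr0 !mul1r.
Qed.

HB.instance Definition _ := bilinear_isBilinear.Build R[i] L2 L2 R[i]
  (GRing.Scale.Law.clone _ _ ( *%R) _)
  (GRing.Scale.Law.clone _ _ (@Num.conj R[i] \; *%R) _) L2_inner
  L2_inner_bilinear.

HB.instance Definition _ := isHermitianSesquilinear.Build R[i] L2 false
  (@Num.conj R[i]) L2_inner L2_innerC.

Let L2_inner_gt0 F : F != 0 -> 0 < L2_inner F F.
Proof.
move=> F0.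
have innerE : L2_inner F F = (\int[mu]_x sqnorm (L2_eval F x))%:C%C.
  rewrite /L2_inner /Cintegral; congr (_ +i* _)%C.
    by apply: eq_Rintegral => x _; rewrite sqnormE.
  rewrite (_ : (fun x => _) = cst 0) ?Rintegral_cst ?mul0r//.
  by apply/funext => x; rewrite inner_norm ger0_Im ?exprn_ge0.
rewrite innerE ltcR lt_neqAle Rintegral_ge0 ?andbT//; last first.
  by move=> x _; exact: sqnorm_ge0.
apply: contra F0 => /eqP/esym intF; apply/eqP/L2_eval_inj.
have Fi := sqnorm_integrable (L2_evalP F).
have : (\int[mu]_x `|(sqnorm (L2_eval F x))%:E| = 0)%E.
  under eq_integral do rewrite gee0_abs ?lee_fin ?sqnorm_ge0//.
  rewrite -[LHS]fineK; last exact: integrable_fin_num.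
  by congr EFin.
move=> /ae_eq_integral_abs F0; have {F0} := F0 measurableT (measurable_int _ Fi).
move=> F0; apply: filterS2 F0 L2_eval0 => x /= /(_ Logic.I)[Fx] ->.
exact: sqnorm_eq0.
Qed.

HB.instance Definition _ := isDotProduct.Build R[i] L2 L2_inner L2_inner_gt0.

HB.instance Definition _ := Lmodule_hasInner.Build R L2 L2_inner.

Lemma L2_innerE (F G : L2) :
  '[F, G] = Cintegral mu (fun x => '[L2_eval F x, L2_eval G x]).
Proof. by []. Qed.

End L2.

Section circle.
Variable R : realType.

Definition circle := {z : R[i] | `|z| == 1}.
HB.instance Definition _ := SubChoice.on circle.

(* The parametrization t |-> e^(2 i pi t); the default value 1 is never used. *)
Definition cis (t : R) : circle :=
  insubd (exist _ 1 (introT eqP (normr1 _)) : circle)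
    (cos (2 * pi * t) +i* sin (2 * pi * t))%C.

Lemma val_cis t : val (cis t) = (cos (2 * pi * t) +i* sin (2 * pi * t))%C.
Proof.
rewrite val_insubd normc_def/= cos2Dsin2 sqrtr1 eqxx//.
Qed.

HB.instance Definition _ := isPointed.Build circle (cis 0).

Definition circle_coord (z : circle) : R * R :=
  (complex.Re (val z), complex.Im (val z)).

(* The Borel sigma-algebra, induced by that of R * R through (Re z, Im z). *)
HB.instance Definition _ :=
  Measurable.copy circle (g_sigma_algebra_preimageType circle_coord).

Lemma measurable_circle_coord : measurable_fun setT circle_coord.
Proof. by move=> _ A mA; exists A. Qed.

Lemma measurable_cis : measurable_fun setT cis.
Proof.
move=> _ _ [A mA <-]; rewrite !setTI -comp_preimage.
rewrite -[X in measurable X]setTI.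
suff : measurable_fun setT (circle_coord \o cis) by apply.
have -> : circle_coord \o cis = (fun t => (cos (2 * pi * t), sin (2 * pi * t))).
  by apply/funext => t; rewrite /= /circle_coord val_cis.
apply/measurable_fun_pair.
- apply: continuous_measurable_fun => t; apply: continuous_comp.
    exact: mulrl_continuous.
  exact: continuous_cos.
- apply: continuous_measurable_fun => t; apply: continuous_comp.
    exact: mulrl_continuous.
  exact: continuous_sin.
Qed.

(* Image of the Lebesgue measure of [0, 1] by cis, hence of total mass 1. *)
Definition circle_measure : set circle -> \bar R :=
  pushforward (mrestr lebesgue_measure (measurable_itv `[0%R, 1%R])) cis.


Let circle_measure0 : circle_measure set0 = 0%E.
Proof. by have mf := measurable_cis; exact: measure0. Qed.

Let circle_measure_ge0 A : (0 <= circle_measure A)%E.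
Proof. by have mf := measurable_cis; exact: measure_ge0. Qed.

Let circle_measure_sigma_additive : semi_sigma_additive circle_measure.
Proof. by have mf := measurable_cis; exact: measure_semi_sigma_additive. Qed.

HB.instance Definition _ := isMeasure.Build _ _ _ circle_measure
  circle_measure0 circle_measure_ge0 circle_measure_sigma_additive.

Lemma circle_measureT : circle_measure setT = 1%E.
Proof.
rewrite /circle_measure /pushforward/= preimage_setT /mrestr setTI.
by rewrite lebesgue_measure_itv/= lte01 oppr0 adde0.
Qed.
HB.instance Definition _ := Measure_isProbability.Build _ _ _ circle_measure circle_measureT.
End circle.

Section subspaces.
Context {R : realType} {V : innerType R}.
Implicit Types (A B H N : set V) (T : V -> V) (f : V).

Definition closed_subspace A := closed A /\ submod_closed [in A].

Definition ominus A B := [set f | A f /\ forall g, B g -> '[f, g] = 0].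

(* The values of ortho_proj and adjoint_on are unique when they exist; they
   exist when N (resp. H) is a closed subspace of a complete space (resp. and
   T is bounded on H). *)
Definition ortho_proj N f : V :=
  xget 0 [set g | N g /\ forall h, N h -> '[f - g, h] = 0].

Definition adjoint_on H T f : V :=
  xget 0 [set g | H g /\ forall h, H h -> '[T h, f] = '[h, g]].

Definition closed_span (I : Type) (v : I -> V) : set V :=
  closure [set f | exists (s : seq I) (c : I -> R[i]),
                     f = \sum_(i <- s) c i *: v i].

Definition orthonormal_basis A (I : choiceType) (v : I -> V) :=
  (forall i j, '[v i, v j] = (i == j)%:R) /\ closed_span v = A.

Definition lin_indep (I : choiceType) (v : I -> V) :=
  forall (s : seq I) (c : I -> R[i]), uniq s ->
    \sum_(i <- s) c i *: v i = 0 -> {in s, forall i, c i = 0}.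

End subspaces.

Section parseval.
Context {R : realType} {V : innerType R}.
Implicit Types (N : set V) (T : V -> V).

Definition parseval_frame N (I : choiceType) (v : I -> V) :=
  [/\ countable [set: I],
      forall i, N (v i) &
      forall f, N f ->
        \esum_(i in [set: I]) (complex.Re (`|'[f, v i]| ^+ 2))%:E =
        (sqnorm f)%:E].

(* Here and below, the operator is the restriction of T to N. *)
Definition parseval_generators N T (I : choiceType) (v : I -> V) :=
  [/\ countable [set: I],
      forall i, v i != 0 &
      parseval_frame N (fun p : I * nat => iter p.2 T (v p.1))].

(* None stands for +oo. *)
Definition parseval_index N T : option nat :=
  let gen d := exists v : 'I_d -> V, parseval_generators N T v in
  if `[< exists d, gen d >] then
    Some (xget 0%N [set d | gen d /\ forall d', gen d' -> (d <= d')%N])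
  else if `[< exists (I : choiceType) (v : I -> V),
                parseval_generators N T v >] then None
  else Some 0%N.

Definition has_card (I : Type) (c : option nat) :=
  if c is Some d then ([set: I] #= `I_d)%card else ([set: I] #= [set: nat])%card.

Definition optimal_parseval_generators N T (I : choiceType) (v : I -> V) :=
  [/\ parseval_generators N T v, lin_indep v &
      has_card I (parseval_index N T)].

End parseval.

Section hardy.
Context {R : realType} (K : sepHilbertType R).

Definition L2T := L2 (@circle_measure R) K.
HB.instance Definition _ := InnerSpace.on L2T.

Lemma L2_pred_cst (u : K) : (fun _ : circle R => u) \in L2_pred (@circle_measure R) K.
Proof.
apply/L2_predP; split; first exact: borel_fun_cst.
by rewrite integral_cst// -[X in (_ * X)%E]/(circle_measure setT) circle_measureT mule1 ltry.
Qed.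

Definition cstT (u : K) : L2T := mkL2 (L2_pred_cst u).

Lemma L2_pred_shift (F : L2T) :
  (fun z : circle R => val z *: L2_eval F z) \in L2_pred (@circle_measure R) K.
Proof.
have /L2_predP[mF Foo] := L2_evalP F; apply/L2_predP; split.
  apply: borel_fun_complexZ => //.
    exact: (measurableT_comp measurable_fst (@measurable_circle_coord R)).
  exact: (measurableT_comp measurable_snd (@measurable_circle_coord R)).
under eq_integral => z _ do rewrite sqnormZ (eqP (valP z)) expr1n mul1r.
exact: Foo.
Qed.

(* S F(z) = z F(z) *)
Definition shift (F : L2T) : L2T := mkL2 (L2_pred_shift F).

(* The coefficient \hat F(n), i.e., the K-valued integral of z^(-n) F(z), is
   characterized weakly. *)
Definition fourier_coeff (F : L2T) (n : int) (a : K) :=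
  forall u : K, '[a, u] =
    Cintegral (@circle_measure R) (fun z => (val z) ^ (- n) * '[L2_eval F z, u]).

Definition hardy : set L2T :=
  [set F | forall n : int, n < 0 -> fourier_coeff F n 0].

Definition constants : set L2T := range cstT.

(* S^* is the adjoint of S as an operator on the Hardy space: on it,
   S^* F(z) = (F(z) - F(0)) / z. *)
Definition backward_shift : L2T -> L2T := adjoint_on hardy shift.

Definition model_space (N : set L2T) :=
  [/\ N `<=` hardy, closed_subspace N &
      forall F, N F -> N (backward_shift F)].

Definition compression (N : set L2T) (F : L2T) : L2T := ortho_proj N (shift F).

Definition wandering (M : set L2T) := ominus M (shift @` M).

Definition full_range (M : set L2T) :=
  exists (I : choiceType) (F : I -> L2T), orthonormal_basis (wandering M) F /\
    {ae @circle_measure R, forall z,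
       closed_span (fun i => L2_eval (F i) z) = [set: K]}.

End hardy.

Arguments hardy {R} K _.
Arguments constants {R} K _.

(* Main.v *)
Require Import Defs.
From HB Require Import structures.
From mathcomp Require Import all_boot all_order all_algebra.
From mathcomp Require Import complex sesquilinear.
From mathcomp Require Import all_classical all_reals all_analysis.
From mathcomp Require Import measurable_realfun.
From mathcomp Require Import ring lra.

Set Implicit Arguments.
Unset Strict Implicit.
Unset Printing Implicit Defensive.

Import Order.TTheory GRing.Theory Num.Theory.
Import numFieldNormedType.Exports.

Local Open Scope classical_set_scope.
Local Open Scope ring_scope.

(** Multiplication by [z] generates a unitary action [zpow] of the integers on
    the square-integrable [K]-valued functions. Write [C] for the constants, [A]
    for the compression of the shift to [N] and [B] for the restriction of the
    backward shift to [N]; they are adjoint to each other on [N].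

    The two systems are Parseval frames. For [f] in [N] the frame coefficients
    of [f] are its inner products with [z ^ n e_j], resp. with
    [z ^ (- n - 1) E_j], for [n >= 0]. Both families are orthonormal because [C]
    and [W] are wandering subspaces for the action, so what has to be seen is
    that [f] lies in their closed spans. The translates of [C] span the whole
    space by uniqueness of Fourier coefficients, and those of [W] because
    moreover [M] is full range ([total_constants], [total_zpow]). Being in the
    Hardy space and orthogonal to [M], which contains all [z ^ n W] with
    [n >= 0], [f] is orthogonal to every translate of [C], resp. of [W], that is
    left out, and to the translates of the intersection of [W] and [C]
    ([parseval_K1], [parseval_W1]).

    They are optimal. If [v] is any system of Parseval generators for [A], the
    Parseval identities of [f] and of its image under the adjoint [B] differ by
    the terms of order zero, so the sum of the squared moduli of the ['[f, v i]]
    is the squared norm of [f] minus that of [B f], whatever [v] is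
    ([parseval_generators_defect]). Hence a vector orthogonal to one generating
    system is orthogonal to every other one, and [d] generators leave room for
    at most [d] linearly independent ones. It is then enough that the given
    systems are linearly independent ([optimal_lin_indep]). A combination of
    the [e_j] with zero projection on [N] is a constant in [M], and a
    combination of the [E_j] killed by the backward shift is a constant in [W];
    both lie in the intersection of [W] and [C], to which they are orthogonal.

    All of this takes place in an abstract space with an action of the integers
    and a wandering subspace. Two analytic facts connect it to functions on the
    circle: the completeness of the space of square-integrable functions
    ([L2_complete]), which provides the orthogonal projections, and the
    uniqueness of Fourier coefficients ([moments0_ae0]). *)

(** * Inner products and closed subspaces *)

Section inner_basics.
Context {R : realType} {V : innerType R}.
Implicit Types (u v w f g h : V) (A B : set V) (z : R[i]).

Lemma innerDl u v w : '[u + v, w] = '[u, w] + '[v, w].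
Proof. exact: linearDl. Qed.

Lemma innerDr u v w : '[w, u + v] = '[w, u] + '[w, v].
Proof. exact: linearDr. Qed.

Lemma innerBl u v w : '[u - v, w] = '[u, w] - '[v, w].
Proof. exact: linearBl. Qed.

Lemma innerBr u v w : '[w, u - v] = '[w, u] - '[w, v].
Proof. exact: linearBr. Qed.

Lemma innerZl z u v : '[z *: u, v] = z * '[u, v].
Proof. exact: linearZl_LR. Qed.

Lemma innerZr z u v : '[u, z *: v] = z^*%C * '[u, v].
Proof. exact: linearZr_LR. Qed.

Lemma inner0l v : '[0, v] = 0.
Proof. exact: linear0l. Qed.

Lemma inner0r v : '[v, 0] = 0.
Proof. exact: linear0r. Qed.

Lemma inner_suml (I : Type) (s : seq I) (F : I -> V) v :
  '[\sum_(i <- s) F i, v] = \sum_(i <- s) '[F i, v].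
Proof.
elim: s => [|i s IH]; first by rewrite !big_nil inner0l.
by rewrite !big_cons innerDl IH.
Qed.

Lemma inner_eq0C u v : '[u, v] = 0 -> '[v, u] = 0.
Proof. by move=> uv; rewrite inner_conj uv conjc0. Qed.

(** The squared modulus as an element of [R]: the modulus itself lives in
    [R[i]], where [lra] and the analysis of real functions do not apply. *)
Definition csq z : R := complex.Re z ^+ 2 + complex.Im z ^+ 2.

Lemma Re_sqr_norm z : complex.Re (`|z| ^+ 2) = csq z.
Proof. by case: z => a b; rewrite sqr_normc/= /csq/=; ring. Qed.

Lemma csq_ge0 z : 0 <= csq z.
Proof. by rewrite addr_ge0// sqr_ge0. Qed.

Lemma csq_eq0 z : csq z = 0 -> z = 0.
Proof.
case: z => a b /eqP; rewrite /csq/= paddr_eq0 ?sqr_ge0//.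
by rewrite !sqrf_eq0 => /andP[/eqP-> /eqP->].
Qed.

Lemma csq_le0 z : (forall e : R, 0 < e -> csq z <= e) -> z = 0.
Proof.
move=> ze; apply: csq_eq0; apply/eqP; rewrite eq_le csq_ge0 andbT.
by apply/ler_addgt0Pr => e e0; rewrite add0r ze.
Qed.

Lemma csq_conj z : csq z^*%C = csq z.
Proof. by case: z => a b; rewrite /csq/= sqrrN. Qed.

Lemma csqM z1 z2 : csq (z1 * z2) = csq z1 * csq z2.
Proof. by case: z1 z2 => a b [c d]; rewrite /csq/=; ring. Qed.

Lemma le_csqD z1 z2 : csq (z1 + z2) <= 2 * (csq z1 + csq z2).
Proof.
case: z1 z2 => a b [c d]; rewrite /csq/= -subr_ge0.
rewrite (_ : _ - _ = (a - c) ^+ 2 + (b - d) ^+ 2); last by ring.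
by rewrite addr_ge0// sqr_ge0.
Qed.

Lemma csq_innerC u v : csq '[u, v] = csq '[v, u].
Proof. by rewrite inner_conj csq_conj. Qed.

Lemma sqnorm0 : sqnorm (0 : V) = 0.
Proof. by rewrite sqnormE inner0l. Qed.

Lemma sqnormZE z u : sqnorm (z *: u) = csq z * sqnorm u.
Proof. by rewrite sqnormZ Re_sqr_norm. Qed.

Lemma sqnormBC u v : sqnorm (u - v) = sqnorm (v - u).
Proof. by rewrite -sqnormN opprB. Qed.

Lemma inner_self_eq0 u : '[u, u] = 0 -> u = 0.
Proof. by move=> u0; apply: sqnorm_eq0; rewrite sqnormE u0. Qed.

Lemma parallelogram u v :
  sqnorm (u + v) + sqnorm (u - v) = 2 * (sqnorm u + sqnorm v).
Proof. by rewrite sqnormB sqnormD mulr2n; ring. Qed.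

(** If no point of the line [u + R[i] v] is closer to the origin than [d],
    comparing with its point closest to the origin bounds the inner product.
    With [d = 0] this is the Cauchy-Schwarz inequality. *)
Lemma csq_inner_le u v (d : R) : (forall z, d <= sqnorm (u - z *: v)) ->
  csq '[u, v] <= (sqnorm u - d) * sqnorm v.
Proof.
move=> dle; have [->|v0] := eqVneq v 0.
  by rewrite inner0r sqnorm0 mulr0 /csq/= expr0n addr0.
have vp : 0 < sqnorm v.
  by rewrite lt_neqAle sqnorm_ge0 andbT; apply: contra v0 => /eqP/esym/sqnorm_eq0->.
have := dle ('[u, v] * (sqnorm v)^-1%:C%C).
rewrite sqnormB sqnormZE innerZr csqM.
set c := '[u, v].
have -> : complex.Re ((c * (sqnorm v)^-1%:C%C)^*%C * c) = csq c / sqnorm v.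
  by case: c => a b; rewrite /csq/=; ring.
have -> : csq (sqnorm v)^-1%:C%C = (sqnorm v)^-1 ^+ 2.
  by rewrite /csq/= expr0n addr0.
have -> : csq c * (sqnorm v)^-1 ^+ 2 * sqnorm v = csq c / sqnorm v.
  by rewrite expr2 -!mulrA mulVf ?mulr1// gt_eqF.
by rewrite -ler_pdivrMr// mulr2n; lra.
Qed.

Lemma Cauchy_Schwarz u v : csq '[u, v] <= sqnorm u * sqnorm v.
Proof.
rewrite -[sqnorm u]subr0; apply: csq_inner_le => z; exact: sqnorm_ge0.
Qed.

Lemma ltr_norm_sqnorm u (e : R) : 0 < e ->
  (`|u| < e%:C%C) = (sqnorm u < e ^+ 2).
Proof.
move=> e0; rewrite /sqnorm -[RHS]ltcR RRe_real ?ger0_real ?exprn_ge0//.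
rewrite rmorphXn/= ltr_pXn2r// ?nnegrE// ?lecR// ltW//.
Qed.

(** Closures are handled through the [R]-valued [sqnorm] throughout. *)
Lemma closureP A f : closure A f <->
  forall e : R, 0 < e -> exists2 g, A g & sqnorm (f - g) < e.
Proof.
split=> [clA e e0|approx B /nbhs_ballP[e /= e0 eB]].
  have se0 : 0 < Num.sqrt e by rewrite sqrtr_gt0.
  have : nbhs f (ball f (Num.sqrt e)%:C%C) by apply: nbhsx_ballx; rewrite ltcR.
  move=> /clA[g [Ag]]; rewrite -ball_normE/= ltr_norm_sqnorm// sqr_sqrtr ?ltW//.
  by exists g.
have re0 : 0 < complex.Re e by rewrite -ltcR RRe_real// gtr0_real.
have [|g Ag fg] := approx (complex.Re e ^+ 2); first by rewrite exprn_gt0.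
exists g; split=> //; apply: eB; rewrite -ball_normE/=.
by rewrite -[e]RRe_real ?gtr0_real// ltr_norm_sqnorm.
Qed.

Lemma closed_subspaceI A B :
  closed_subspace A -> closed_subspace B -> closed_subspace (A `&` B).
Proof.
move=> [cA [A0 AD]] [cB [B0 BD]]; split; first exact: closedI.
split; first by rewrite inE; split; apply: set_mem.
move=> c u v; rewrite !inE => -[Au Bu] [Av Bv]; split; apply: set_mem.
  by apply: AD; rewrite inE.
by apply: BD; rewrite inE.
Qed.

Lemma closed_perp g : closed_subspace [set f | '[f, g] = 0].
Proof.
split; last first.
  split; first by rewrite inE/= inner0l.
  move=> c u v; rewrite !inE/= => ug vg.
  by rewrite innerDl innerZl ug vg mulr0 addr0.
move=> f /closureP fcl; apply: csq_le0 => e e0.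
have g1 : 0 < sqnorm g + 1 by rewrite ltr_wpDl// sqnorm_ge0.
have [|h /= hg fh] := fcl (e / (sqnorm g + 1)); first by rewrite divr_gt0.
rewrite -[f](subrK h) innerDl hg addr0 (le_trans (Cauchy_Schwarz _ _))//.
move: fh; rewrite ltr_pdivlMr// => /ltW; apply: le_trans.
by rewrite ler_wpM2l ?sqnorm_ge0// lerDl.
Qed.

Lemma closed_bigperp B : closed_subspace [set f | forall g, B g -> '[f, g] = 0].
Proof.
have -> : [set f | forall g, B g -> '[f, g] = 0] =
    \bigcap_(g in B) [set f | '[f, g] = 0] by [].
split; first by apply: closed_bigI => g _; have [] := closed_perp g.
split; first by rewrite inE => g _; rewrite /= inner0l.
move=> c u v; rewrite !inE => uB vB g Bg /=.
by rewrite innerDl innerZl uB// vB// mulr0 addr0.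
Qed.

Lemma closed_ominus A B : closed_subspace A -> closed_subspace (ominus A B).
Proof.
by move=> cA; apply: (closed_subspaceI cA); exact: closed_bigperp.
Qed.

Section subspace.
Context A (cA : closed_subspace A).

Lemma subspace0 : A 0.
Proof. by case: cA => _ [] /set_mem. Qed.

Lemma subspaceP c u v : A u -> A v -> A (c *: u + v).
Proof. by case: cA => _ [_ AD] Au Av; apply: set_mem; apply: AD; rewrite inE. Qed.

Lemma subspaceD u v : A u -> A v -> A (u + v).
Proof. by rewrite -{2}[u]scale1r; exact: subspaceP. Qed.

Lemma subspaceZ c u : A u -> A (c *: u).
Proof. by move=> Au; rewrite -[_ *: _]addr0; apply: subspaceP => //; exact: subspace0. Qed.

Lemma subspaceB u v : A u -> A v -> A (u - v).
Proof. by move=> Au Av; rewrite addrC -scaleN1r; exact: subspaceP. Qed.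

Lemma subspace_sum (I : Type) (s : seq I) (F : I -> V) :
  (forall i, A (F i)) -> A (\sum_(i <- s) F i).
Proof.
move=> AF; elim: s => [|i s IH]; first by rewrite big_nil; exact: subspace0.
by rewrite big_cons; exact: subspaceD.
Qed.

Lemma closed_span_sub (I : Type) (x : I -> V) :
  (forall i, A (x i)) -> closed_span x `<=` A.
Proof.
move=> Ax; have [clA _] := cA.
rewrite closure_id in clA; rewrite clA; apply: closure_subset => _ [s [c ->]].
by apply: subspace_sum => i; exact: subspaceZ.
Qed.

End subspace.

Lemma span_sub (I : Type) (x : I -> V) (s : seq I) (c : I -> R[i]) :
  closed_span x (\sum_(i <- s) c i *: x i).
Proof.
apply/closureP => e e0; exists (\sum_(i <- s) c i *: x i); first by exists s, c.
by rewrite subrr sqnorm0.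
Qed.

Lemma sub_closed_span (I : Type) (x : I -> V) i : closed_span x (x i).
Proof.
have := @span_sub _ x [:: i] (fun=> 1).
by rewrite big_cons big_nil addr0 scale1r.
Qed.

(** Linear combinations in [closed_span] run over sequences with possible
    repetitions, while the coefficient depends on the index only; two of them
    are compared over a common duplicate-free sequence. *)
Lemma sum_count_mem (I : eqType) (G : I -> V) (r r' : seq I) :
  uniq r' -> {subset r <= r'} ->
  \sum_(i <- r) G i = \sum_(i <- r') G i *+ count_mem i r.
Proof.
move=> ur'; elim: r => [|j r IH] rr'; first by rewrite big_nil big1.
rewrite big_cons IH; last by move=> i ir; apply: rr'; rewrite inE ir orbT.
under [RHS]eq_bigr do rewrite /= mulrnDr.
rewrite big_split/=; congr (_ + _).
rewrite (bigD1_seq j)//=; last by apply: rr'; rewrite mem_head.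
by rewrite eqxx mulr1n big1 ?addr0// => i ij; rewrite eq_sym (negbTE ij) mulr0n.
Qed.

Lemma closed_span_subspace (I : eqType) (x : I -> V) :
  closed_subspace (closed_span x).
Proof.
split; first exact: closed_closure.
split; first by have := @span_sub _ x [::] (fun=> 0); rewrite big_nil inE.
move=> c u v; rewrite !inE => /closureP ucl /closureP vcl.
apply/closureP => e e0.
have c1 : 0 < csq c + 1 by rewrite ltr_wpDl// csq_ge0.
have [|_ [s [a ->]] us] := ucl (e / 4 / (csq c + 1)); first by rewrite !divr_gt0.
have [|_ [t [b ->]] vt] := vcl (e / 4); first by rewrite !divr_gt0.
exists (c *: (\sum_(i <- s) a i *: x i) + \sum_(i <- t) b i *: x i).
  exists (undup (s ++ t)), (fun i => c * (a i *+ count_mem i s) + b i *+ count_mem i t).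
  rewrite (@sum_count_mem _ _ s (undup (s ++ t))) ?undup_uniq//; last first.
    by move=> i si; rewrite mem_undup mem_cat si.
  rewrite (@sum_count_mem _ _ t (undup (s ++ t))) ?undup_uniq//; last first.
    by move=> i si; rewrite mem_undup mem_cat si orbT.
  rewrite scaler_sumr -big_split/=; apply: eq_bigr => i _.
  by rewrite scalerDl -scalerA !scalerMnl.
rewrite opprD addrACA -scalerBr.
set U := u - _ in us *; set W := v - _ in vt *.
rewrite (le_lt_trans (le_sqnormD _ _))// sqnormZE.
have : csq c * sqnorm U <= (csq c + 1) * sqnorm U.
  by rewrite ler_wpM2r ?sqnorm_ge0// lerDl.
by move: us; rewrite ltr_pdivlMr// [sqnorm U * _]mulrC; lra.
Qed.

End inner_basics.

(** * Completeness, projections and the Parseval identity *)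

Section sequences_and_sums.
Context {R : realType}.

Lemma inv_succ_small (e : R) : 0 < e ->
  exists N, forall n, (N <= n)%N -> n.+1%:R^-1 < e.
Proof.
move=> e0; have [N] := @ltr_add_invr R 0 _ e0; rewrite add0r => Ne.
by exists N => n Nn; rewrite (le_lt_trans _ Ne)// lef_pV2 ?posrE// ler_nat.
Qed.

Lemma esum_le_seq (I : choiceType) (a : I -> R) (M : R) :
  (forall s, uniq s -> \sum_(i <- s) a i <= M) ->
  (\esum_(i in [set: I]) (a i)%:E <= M%:E)%E.
Proof.
move=> aM; apply: ge_ereal_sup => _ [A [finA _] <-].
by rewrite fsbig_finite// sumEFin lee_fin aM.
Qed.

Lemma esum_ge_seq (I : choiceType) (a : I -> R) s : uniq s ->
  ((\sum_(i <- s) a i)%:E <= \esum_(i in [set: I]) (a i)%:E)%E.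
Proof.
move=> us; apply: esum_ge; exists [set` s].
  by split=> //; exact: finite_seq.
by rewrite -fsbig_seq// sumEFin.
Qed.

End sequences_and_sums.

Section completeness.
Context {R : realType} {V : innerType R}.
Implicit Types (A : set V) (u : nat -> V) (f g h l : V).

Definition cauchy_sqnorm u := forall e : R, 0 < e ->
  exists N, forall m n, (N <= m)%N -> (N <= n)%N -> sqnorm (u m - u n) < e.

Definition cvg_sqnorm u l := forall e : R, 0 < e ->
  exists N, forall n, (N <= n)%N -> sqnorm (u n - l) < e.

Definition complete_set A := forall u, (forall n, A (u n)) -> cauchy_sqnorm u ->
  exists2 l, A l & cvg_sqnorm u l.

Lemma cvg_cauchy_sqnorm u l : cvg_sqnorm u l -> cauchy_sqnorm u.
Proof.
move=> ul e e0; have [|N NP] := ul (e / 4); first by rewrite divr_gt0.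
exists N => m n Nm Nn; rewrite -[u m](subrK l) -addrA.
rewrite (le_lt_trans (le_sqnormD _ _))// [sqnorm (l - _)]sqnormBC.
by have := NP _ Nm; have := NP _ Nn; lra.
Qed.

Lemma cvg_sqnorm_unique u l l' : cvg_sqnorm u l -> cvg_sqnorm u l' -> l = l'.
Proof.
move=> ul ul'; apply/eqP; rewrite -subr_eq0; apply/eqP/sqnorm_eq0/eqP.
rewrite eq_le sqnorm_ge0 andbT; apply/ler_addgt0Pr => e e0.
have [|N NP] := ul (e / 4); first by rewrite divr_gt0.
have [|N' NP'] := ul' (e / 4); first by rewrite divr_gt0.
have := NP _ (leq_maxl N N'); have := NP' _ (leq_maxr N N').
set v := u _; have := le_sqnormD (l - v) (v - l').
by rewrite subrKA [sqnorm (l - v)]sqnormBC add0r; lra.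
Qed.

Lemma closed_complete A A' : A' `<=` A -> closed A' ->
  complete_set A -> complete_set A'.
Proof.
move=> AA' clA cA u uA' /cA[n|l _ ul]; first exact: AA'.
exists l => //; apply: clA; apply/closureP => e /ul[N NP].
by exists (u N) => //; rewrite sqnormBC NP.
Qed.

Lemma complete_closed A : complete_set A -> closed A.
Proof.
move=> cA f /closureP fA.
have /choice[u uP] : forall n, exists g, A g /\ sqnorm (f - g) < n.+1%:R^-1.
  by move=> n; have [|g] := fA n.+1%:R^-1; [rewrite invr_gt0|exists g].
have uf : cvg_sqnorm u f.
  move=> e /inv_succ_small[N NP]; exists N => n /NP.
  by rewrite sqnormBC; apply: lt_trans; case: (uP n).
have [n|l Al ul] := cA u _ (cvg_cauchy_sqnorm uf); first by case: (uP n).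
by rewrite (cvg_sqnorm_unique uf ul).
Qed.

(** A minimizing sequence for the distance from [f] to [A] is Cauchy by the
    parallelogram law. *)
Lemma exists_projection A f : closed_subspace A -> complete_set A ->
  exists2 g, A g & forall h, A h -> '[f - g, h] = 0.
Proof.
move=> sA cA; pose D := [set sqnorm (f - a) | a in A].
have D0 : has_inf D.
  split; first by exists (sqnorm (f - 0)), 0 => //; exact: subspace0.
  by exists 0 => _ [a _ <-]; exact: sqnorm_ge0.
have dle a : A a -> inf D <= sqnorm (f - a).
  by move=> Aa; apply: ge_inf; [case: D0|exists a].
have /choice[u uP] : forall n, exists a, A a /\ sqnorm (f - a) < inf D + n.+1%:R^-1.
  move=> n; have [|_ [a Aa <-] ad] := @inf_adherent _ D n.+1%:R^-1 _ D0.
    by rewrite invr_gt0.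
  by exists a.
have uA n : A (u n) by case: (uP n).
have small (e : R) : 0 < e -> exists N, forall n, (N <= n)%N ->
    sqnorm (f - u n) < inf D + e.
  move=> /inv_succ_small[N NP]; exists N => n /NP ne.
  by rewrite (lt_trans (uP n).2)// ltrD2l.
have [|l Al ul] := cA u uA.
  move=> e e0; have [|N NP] := small (e / 4); first by rewrite divr_gt0.
  exists N => m n Nm Nn.
  have := dle (2^-1 *: (u m + u n)).
  have /[swap]/[apply] : A (2^-1 *: (u m + u n)).
    by apply: (subspaceZ sA); apply: subspaceD.
  have := parallelogram (f - u n) (f - u m).
  have -> : f - u n - (f - u m) = u m - u n by rewrite opprB addrC addrA subrK.
  have -> : f - u n + (f - u m) = 2 *: (f - 2^-1 *: (u m + u n)).
    rewrite scalerBr scalerA divff ?pnatr_eq0// scale1r scaler_nat mulr2n.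
    by rewrite addrACA -opprD [u n + _]addrC.
  rewrite sqnormZE (_ : csq 2 = 4); last first.
    rewrite (_ : 2 = (2%:R : R)%:C%C); last by rewrite rmorph_nat.
    by rewrite /csq/= expr0n addr0 -natrX.
  by have := NP _ Nm; have := NP _ Nn; lra.
(* Orthogonality is read off the almost minimizing [u n] and passed to the
   limit, which avoids the continuity of the distance. *)
exists l => // h Ah; apply: csq_le0 => e e0.
have h1 : 0 < sqnorm h + 1 by rewrite ltr_wpDl// sqnorm_ge0.
have d0 : 0 < e / 4 / (sqnorm h + 1) by rewrite !divr_gt0.
have [N NP] := small _ d0; have [N' NP'] := ul _ d0.
have := NP _ (leq_maxl N N'); have := NP' _ (leq_maxr N N').
have := uA (maxn N N'); set v := u _ => Av vl fv.
rewrite -[f](subrK v) -addrA innerDl (le_trans (le_csqD _ _))//.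
have c1 := Cauchy_Schwarz (v - l) h.
have c2 : csq '[f - v, h] <= (sqnorm (f - v) - inf D) * sqnorm h.
  apply: csq_inner_le => z; rewrite -addrA -opprD dle//.
  by apply: (subspaceD sA) => //; exact: subspaceZ.
have bnd t : t < e / 4 / (sqnorm h + 1) -> t * sqnorm h <= e / 4.
  move=> td; apply: (@le_trans _ _ (e / 4 / (sqnorm h + 1) * sqnorm h)).
    by rewrite ler_wpM2r ?sqnorm_ge0// ltW.
  by rewrite -mulrA ler_piMr// ?divr_ge0 ?ltW// mulrC ltr_pdivrMr// mul1r ltrDl.
have := bnd _ vl; have := bnd (sqnorm (f - v) - inf D).
rewrite ltrBlDl => /(_ fv).
lra.
Qed.

End completeness.

Section orthonormal.
Context {R : realType} {V : innerType R} (I : choiceType) (x : I -> V).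
Hypothesis ox : forall i j, '[x i, x j] = (i == j)%:R.
Implicit Types (s : seq I) (c : I -> R[i]) (f : V).

(** The best approximation of [f] has coefficients ['[f, x i]]; the last sum is
    the price of any other choice. *)
Lemma sqnorm_sub_comb s c f : uniq s ->
  sqnorm (f - \sum_(i <- s) c i *: x i) =
  sqnorm f - \sum_(i <- s) csq '[f, x i] + \sum_(i <- s) csq ('[f, x i] - c i).
Proof.
elim: s f => [|i s IH] f /=; first by rewrite !big_nil !subr0 addr0.
move=> /andP[si us]; rewrite !big_cons opprD addrA IH//.
have E j : j \in s -> '[f - c i *: x i, x j] = '[f, x j].
  move=> js; rewrite innerBl innerZl ox (_ : (i == j) = false) ?mulr0 ?subr0//.
  by apply/negbTE; apply: contra si => /eqP->.
rewrite (_ : \sum_(j <- s) csq '[f - c i *: x i, x j] =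
             \sum_(j <- s) csq '[f, x j]); last first.
  by apply: eq_big_seq => j js; rewrite E.
rewrite (_ : \sum_(j <- s) csq ('[f - c i *: x i, x j] - c j) =
             \sum_(j <- s) csq ('[f, x j] - c j)); last first.
  by apply: eq_big_seq => j js; rewrite E.
rewrite sqnormB sqnormZE innerZr (sqnormE (x i)) ox eqxx/= mulr1.
set z := '[f, x i].
have -> : csq (c i) = csq (z - c i) - csq z + complex.Re ((c i)^*%C * z) *+ 2.
  by case: (c i) z => a b [p q]; rewrite /csq/= mulr2n; ring.
ring.
Qed.

Lemma Bessel s f : uniq s -> \sum_(i <- s) csq '[f, x i] <= sqnorm f.
Proof.
move=> us; have := sqnorm_ge0 (f - \sum_(i <- s) '[f, x i] *: x i).
rewrite sqnorm_sub_comb// [X in _ + X]big1 ?addr0 ?subr_ge0// => i _.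
by rewrite subrr /csq/= expr0n addr0.
Qed.

Lemma orthonormal_parseval f : closed_span x f ->
  \esum_(i in [set: I]) (csq '[f, x i])%:E = (sqnorm f)%:E.
Proof.
move=> /closureP fx; apply/eqP; rewrite eq_le; apply/andP; split.
  by apply: esum_le_seq => s; exact: Bessel.
apply/lee_addgt0Pr => e e0; have [_ [s [c ->]] fs] := fx e e0.
apply: (@le_trans _ _ ((\sum_(i <- undup s) csq '[f, x i])%:E + e%:E)%E); last first.
  by rewrite leeD2r// esum_ge_seq// undup_uniq.
rewrite -EFinD lee_fin; move: fs.
rewrite (@sum_count_mem _ _ _ _ s (undup s)) ?undup_uniq//; last first.
  by move=> i; rewrite mem_undup.
under eq_bigr do rewrite scalerMnl.
rewrite sqnorm_sub_comb ?undup_uniq// => fs; rewrite -lerBlDl.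
apply: le_trans (ltW fs); rewrite lerDl sumr_ge0// => i _; exact: csq_ge0.
Qed.

End orthonormal.

(** * Integrals of complex functions *)

Section complex_integrable.
Context d (T : measurableType d) (R : realType) (mu : {measure set T -> \bar R}).
Implicit Types (f g : T -> R) (F G : T -> R[i]).

Definition rintegrable f := mu.-integrable setT (EFin \o f).

Definition cintegrable F :=
  rintegrable (fun x => complex.Re (F x)) /\ rintegrable (fun x => complex.Im (F x)).

Lemma rintegrable_measurable f : rintegrable f -> measurable_fun setT f.
Proof. by move=> /measurable_int/measurable_EFinP. Qed.

Lemma rintegrableZ (a : R) f : rintegrable f -> rintegrable (fun x => a * f x).
Proof. by move=> fi; have := integrableZl measurableT a fi. Qed.

Lemma rintegrableD f g : rintegrable f -> rintegrable g ->
  rintegrable (fun x => f x + g x).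
Proof. by move=> fi gi; have := integrableD measurableT fi gi. Qed.

Lemma rintegrableB f g : rintegrable f -> rintegrable g ->
  rintegrable (fun x => f x - g x).
Proof. by move=> fi gi; have := integrableB measurableT fi gi. Qed.

Lemma rintegrableM (b : T -> R) (M : R) f : measurable_fun setT b ->
  (forall x, `|b x| <= M) -> rintegrable f -> rintegrable (fun x => b x * f x).
Proof.
move=> mb bM fi; apply: (integrableMr measurableT mb _ fi).
by exists M; split=> [|y My x _ /=]; [exact: num_real|exact: le_trans (bM x) (ltW My)].
Qed.

Lemma cintegrableM (B : T -> R[i]) (M : R) F :
  measurable_fun setT (fun x => complex.Re (B x)) ->
  measurable_fun setT (fun x => complex.Im (B x)) ->
  (forall x, `|complex.Re (B x)| <= M) -> (forall x, `|complex.Im (B x)| <= M) ->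
  cintegrable F -> cintegrable (fun x => B x * F x).
Proof.
move=> mr mi rM iM [Fr Fi]; split.
  rewrite (_ : (fun _ => _) = (fun x => complex.Re (B x) * complex.Re (F x) -
                                  complex.Im (B x) * complex.Im (F x))).
    by apply: rintegrableB; exact: rintegrableM.
  by apply/funext => x /=; case: (B x) (F x) => ? ? [].
rewrite (_ : (fun _ => _) = (fun x => complex.Re (B x) * complex.Im (F x) +
                                complex.Im (B x) * complex.Re (F x))).
  by apply: rintegrableD; exact: rintegrableM.
by apply/funext => x /=; case: (B x) (F x) => ? ? [].
Qed.

Lemma cintegrableZ (c : R[i]) F :
  cintegrable F -> cintegrable (fun x => c * F x).
Proof.
apply: (@cintegrableM (fun=> c) (`|complex.Re c| + `|complex.Im c|)).
- exact: measurable_cst.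
- exact: measurable_cst.
- by move=> _; rewrite lerDl.
- by move=> _; rewrite lerDr.
Qed.

Lemma cintegrableD F G :
  cintegrable F -> cintegrable G -> cintegrable (fun x => F x + G x).
Proof.
move=> [Fr Fi] [Gr Gi]; split.
  rewrite (_ : (fun _ => _) = (fun x => complex.Re (F x) + complex.Re (G x))).
    exact: rintegrableD.
  by apply/funext => x /=; rewrite raddfD.
rewrite (_ : (fun _ => _) = (fun x => complex.Im (F x) + complex.Im (G x))).
  exact: rintegrableD.
by apply/funext => x /=; rewrite raddfD.
Qed.

Lemma CintegralD F G : cintegrable F -> cintegrable G ->
  Cintegral mu (fun x => F x + G x) = Cintegral mu F + Cintegral mu G.
Proof.
move=> [Fr Fi] [Gr Gi]; rewrite /Cintegral; apply/eqP; rewrite eq_complex/=.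
apply/andP; split; apply/eqP.
  by rewrite -(RintegralD _ Fr Gr)//; apply: eq_Rintegral => x _; rewrite raddfD.
by rewrite -(RintegralD _ Fi Gi)//; apply: eq_Rintegral => x _; rewrite raddfD.
Qed.

Lemma CintegralZ (c : R[i]) F : cintegrable F ->
  Cintegral mu (fun x => c * F x) = c * Cintegral mu F.
Proof.
move=> [Fr Fi]; rewrite /Cintegral; case: c => a b.
apply/eqP; rewrite eq_complex/=; apply/andP; split; apply/eqP.
  rewrite -!RintegralZl// -RintegralB//; try exact: rintegrableZ.
  by apply: eq_Rintegral => x _; case: (F x).
rewrite -!RintegralZl// -RintegralD//; try exact: rintegrableZ.
by apply: eq_Rintegral => x _; case: (F x).
Qed.

Lemma eq_Cintegral F G : F =1 G -> Cintegral mu F = Cintegral mu G.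
Proof. by move=> /funext->. Qed.

(** Dominated convergence, with [M * `|f|] as the dominating function. *)
Lemma Rintegral_bounded_lim0 (b : nat -> T -> R) (B : T -> R) (M : R) f :
  (forall n, measurable_fun setT (b n)) -> (forall n x, `|b n x| <= M) ->
  (forall x, b n x @[n --> \oo] --> B x) -> rintegrable f ->
  (forall n, \int[mu]_x (b n x * f x) = 0) -> \int[mu]_x (B x * f x) = 0.
Proof.
move=> mb bM bB fi b0; rewrite /Rintegral.
have Mf : mu.-integrable setT (EFin \o (fun x => M * `|f x|)).
  by apply: rintegrableZ; have := integrable_abse fi.
have cvg : (fun n => (\int[mu]_x (b n x * f x)%:E)%E) @ \oo -->
    (\int[mu]_x (B x * f x)%:E)%E.
  apply: (@dominated_cvg _ _ _ mu setT measurableT _ _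
    (EFin \o (fun x => M * `|f x|))) => //.
  - move=> n; apply/measurable_EFinP; apply: measurable_funM => //.
    exact: rintegrable_measurable.
  - by move=> x _; apply: cvg_EFin; [exact: nearW|apply: cvgMl; exact: bB].
  - by move=> n x _; rewrite lee_fin normrM ler_wpM2r.
have b0E n : (\int[mu]_x (b n x * f x)%:E = 0)%E.
  rewrite -[LHS]fineK; first by congr EFin; exact: b0.
  apply: integrable_fin_num => //; exact: (@rintegrableM _ M).
move: cvg; rewrite (_ : (fun n => _) = cst 0%E); last exact/funext.
by move/cvg_lim => <- //; rewrite lim_cst.
Qed.

End complex_integrable.

(** * Uniqueness of Fourier coefficients *)

Section circle_moments.
Context {R : realType}.
Local Notation mu := (@circle_measure R).
Implicit Types (psi : circle R -> R[i]) (b : circle R -> R).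

Lemma circle_neq0 (z : circle R) : val z != 0.
Proof. by rewrite -normr_eq0 (eqP (valP z)) oner_eq0. Qed.

Lemma circle_inv (z : circle R) : (val z)^-1 = (val z)^*%C.
Proof.
apply: (mulfI (circle_neq0 z)); rewrite mulfV ?circle_neq0//.
by have := normCK (val z); rewrite (eqP (valP z)) expr1n.
Qed.

Lemma circle_Re_le1 (z : circle R) : `|complex.Re (val z)| <= 1.
Proof. by rewrite -lecR (le_trans (normc_ge_Re _))// (eqP (valP z)). Qed.

Lemma circle_Im_le1 (z : circle R) : `|complex.Im (val z)| <= 1.
Proof.
have : csq (val z) = 1 by rewrite -Re_sqr_norm (eqP (valP z)) expr1n.
rewrite /csq -ler_sqr ?nnegrE// real_normK ?num_real// expr1n => <-.
by rewrite lerDr sqr_ge0.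
Qed.

Lemma measurable_circle_Re :
  measurable_fun setT (fun z : circle R => complex.Re (val z)).
Proof.
exact: (measurableT_comp measurable_fst (@measurable_circle_coord R)).
Qed.

Lemma measurable_circle_Im :
  measurable_fun setT (fun z : circle R => complex.Im (val z)).
Proof.
exact: (measurableT_comp measurable_snd (@measurable_circle_coord R)).
Qed.

Lemma circle_expzS (z : circle R) (n : int) : val z ^ (n + 1) = val z * val z ^ n.
Proof. by rewrite expfzDr ?circle_neq0// expr1z mulrC. Qed.

Lemma circle_expzP (z : circle R) (n : int) :
  val z ^ (n - 1) = (val z)^-1 * val z ^ n.
Proof. by rewrite expfzDr ?circle_neq0// -invr_expz expr1z mulrC. Qed.

Lemma cintegrable_zM psi :
  cintegrable mu psi -> cintegrable mu (fun z => val z * psi z).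
Proof.
apply: (@cintegrableM _ _ _ _ _ 1).
- exact: measurable_circle_Re.
- exact: measurable_circle_Im.
- exact: circle_Re_le1.
- exact: circle_Im_le1.
Qed.

Lemma cintegrable_zV psi :
  cintegrable mu psi -> cintegrable mu (fun z => (val z)^-1 * psi z).
Proof.
have ReV (z : circle R) : complex.Re (val z)^-1 = complex.Re (val z).
  by rewrite circle_inv; case: (val z).
have ImV (z : circle R) : complex.Im (val z)^-1 = - complex.Im (val z).
  by rewrite circle_inv; case: (val z).
apply: (@cintegrableM _ _ _ _ _ 1).
- by under eq_fun do rewrite ReV; exact: measurable_circle_Re.
- under eq_fun do rewrite ImV.
  by apply: measurableT_comp => //; exact: measurable_circle_Im.
- by move=> z; rewrite ReV; exact: circle_Re_le1.
- by move=> z; rewrite ImV normrN; exact: circle_Im_le1.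
Qed.

Lemma cintegrable_zX (n : int) psi :
  cintegrable mu psi -> cintegrable mu (fun z => val z ^ n * psi z).
Proof.
move=> ipsi; elim: n => [|n IH|n IH].
- by rewrite (_ : (fun _ => _) = psi)//; apply/funext => z; rewrite expr0z mul1r.
- rewrite (_ : (fun _ => _) = (fun z => val z * (val z ^ n%:Z * psi z))).
    exact: cintegrable_zM.
  by apply/funext => z; rewrite -addn1 PoszD circle_expzS mulrA.
- rewrite (_ : (fun _ => _) = (fun z => (val z)^-1 * (val z ^ (- n%:Z) * psi z))).
    exact: cintegrable_zV.
  by apply/funext => z; rewrite -addn1 PoszD opprD circle_expzP mulrA.
Qed.

Definition moments0 psi :=
  cintegrable mu psi /\ forall n : int, Cintegral mu (fun z => val z ^ n * psi z) = 0.

Lemma moments0_comb (c : R[i]) psi1 psi2 : moments0 psi1 -> moments0 psi2 ->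
  moments0 (fun z => c * psi1 z + psi2 z).
Proof.
move=> [i1 m1] [i2 m2]; split.
  by apply: cintegrableD => //; exact: cintegrableZ.
move=> n; transitivity (Cintegral mu (fun z : circle R =>
    c * (val z ^ n * psi1 z) + val z ^ n * psi2 z)).
  by apply: eq_Cintegral => z; rewrite mulrDr mulrCA.
have j1 := cintegrable_zX n i1; have j2 := cintegrable_zX n i2.
by rewrite CintegralD ?CintegralZ ?m1 ?m2 ?mulr0 ?addr0//; exact: cintegrableZ.
Qed.

Lemma moments0Z (c : R[i]) psi : moments0 psi -> moments0 (fun z => c * psi z).
Proof.
move=> mpsi; have := moments0_comb (c - 1) mpsi mpsi.
rewrite (_ : (fun _ => _) = (fun z => c * psi z))//.
by apply/funext => z; rewrite mulrBl mul1r subrK.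
Qed.

Lemma moments0_zM psi : moments0 psi -> moments0 (fun z => val z * psi z).
Proof.
move=> [ip mp]; split; first exact: cintegrable_zM.
move=> n; rewrite -(mp (n + 1)); apply: eq_Cintegral => z.
by rewrite circle_expzS mulrCA mulrA.
Qed.

Lemma moments0_zV psi : moments0 psi -> moments0 (fun z => (val z)^-1 * psi z).
Proof.
move=> [ip mp]; split; first exact: cintegrable_zV.
move=> n; rewrite -(mp (n - 1)); apply: eq_Cintegral => z.
by rewrite circle_expzP mulrCA mulrA.
Qed.

(** The bounded functions [b] that preserve the integrable functions whose
    Fourier coefficients all vanish. They form an algebra containing the two
    coordinates and closed under bounded pointwise limits, so the sets whose
    indicator is a multiplier turn out to be all the Borel sets. *)
Definition multiplier b :=
  [/\ measurable_fun setT b, exists M, forall z, `|b z| <= M &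
      forall psi, moments0 psi -> moments0 (fun z => (b z)%:C%C * psi z)].

Lemma multiplier_cst (r : R) : multiplier (fun=> r).
Proof.
by split; [exact: measurable_cst|exists `|r| => _|move=> psi; exact: moments0Z].
Qed.

Lemma multiplierD b1 b2 : multiplier b1 -> multiplier b2 ->
  multiplier (fun z => b1 z + b2 z).
Proof.
move=> [m1 [M1 M1P] mu1] [m2 [M2 M2P] mu2]; split.
- exact: measurable_funD.
- by exists (M1 + M2) => z; rewrite (le_trans (ler_normD _ _))// lerD.
move=> psi mpsi; have := moments0_comb 1 (mu1 _ mpsi) (mu2 _ mpsi).
rewrite (_ : (fun _ => _) = (fun z => (b1 z + b2 z)%:C%C * psi z))//.
by apply/funext => z; rewrite mul1r rmorphD mulrDl.
Qed.

Lemma multiplierM b1 b2 : multiplier b1 -> multiplier b2 ->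
  multiplier (fun z => b1 z * b2 z).
Proof.
move=> [m1 [M1 M1P] mu1] [m2 [M2 M2P] mu2]; split.
- exact: measurable_funM.
- by exists (M1 * M2) => z; rewrite normrM ler_pM.
move=> psi mpsi; have := mu1 _ (mu2 _ mpsi).
rewrite (_ : (fun _ => _) = (fun z => (b1 z * b2 z)%:C%C * psi z))//.
by apply/funext => z; rewrite rmorphM mulrA.
Qed.

Lemma multiplierX b n : multiplier b -> multiplier (fun z => b z ^+ n).
Proof.
move=> mb; elim: n => [|n IH]; first exact: multiplier_cst.
by under eq_fun do rewrite exprS; exact: multiplierM.
Qed.

Lemma multiplierZ (r : R) b : multiplier b -> multiplier (fun z => r * b z).
Proof. exact/multiplierM/multiplier_cst. Qed.

(** On the circle [2 Re z = z + z^-1], and multiplying by [z] or [z^-1] shifts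
    the Fourier coefficients. *)
Lemma multiplier_Re : multiplier (fun z => complex.Re (val z)).
Proof.
split; [exact: measurable_circle_Re|exists 1; exact: circle_Re_le1|].
move=> psi mpsi.
have := moments0Z 2^-1 (moments0_comb 1 (moments0_zM mpsi) (moments0_zV mpsi)).
rewrite (_ : (fun _ => _) = (fun z : circle R => (complex.Re (val z))%:C%C * psi z))//.
apply/funext => z; rewrite mul1r -mulrDl circle_inv mulrA; congr (_ * _).
apply: (mulfI (_ : 2 != 0)); first by rewrite pnatr_eq0.
rewrite mulrA mulfV ?pnatr_eq0// mul1r.
by case: (val z) => a b; apply/eqP; rewrite eq_complex/=; apply/andP; split; apply/eqP; ring.
Qed.

Lemma multiplier_Im : multiplier (fun z => complex.Im (val z)).
Proof.
split; [exact: measurable_circle_Im|exists 1; exact: circle_Im_le1|].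
move=> psi mpsi.
have := moments0Z (2^-1 * 'i%C) (moments0_comb (-1) (moments0_zM mpsi) (moments0_zV mpsi)).
rewrite (_ : (fun _ => _) = (fun z : circle R => (complex.Im (val z))%:C%C * psi z))//.
apply/funext => z; rewrite [-1 * _]mulrA -mulrDl circle_inv mulrA; congr (_ * _).
apply: (mulfI (_ : 2 != 0)); first by rewrite pnatr_eq0.
rewrite !mulrA mulfV ?pnatr_eq0// mul1r.
by case: (val z) => a b; apply/eqP; rewrite eq_complex/=; apply/andP; split; apply/eqP; ring.
Qed.

Lemma multiplier_lim (b : nat -> circle R -> R) B (M : R) :
  (forall n, multiplier (b n)) -> (forall n z, `|b n z| <= M) ->
  (forall z, b n z @[n --> \oo] --> B z) -> multiplier B.
Proof.
move=> mb bM bB.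
have BM z : `|B z| <= M.
  have bz : `|b n z| @[n --> \oo] --> `|B z| by apply: cvg_norm; exact: bB.
  rewrite -(cvg_lim _ bz)//; apply: limr_le; first by apply: cvgP bz.
  by apply: nearW => n.
have mB : measurable_fun setT B.
  apply: (@measurable_fun_cvg _ _ _ setT b) => //; first by move=> n; case: (mb n).
split=> //; first by exists M.
move=> psi mpsi; have [ipsi _] := mpsi.
have ib : cintegrable mu (fun z => (B z)%:C%C * psi z).
  apply: (@cintegrableM _ _ _ _ _ M) => //=.
  by move=> z; rewrite normr0 (le_trans _ (BM z)).
split=> // n.
have nE (a : circle R -> R) : Cintegral mu (fun z => val z ^ n * ((a z)%:C%C * psi z)) =
   ((\int[mu]_z (a z * complex.Re (val z ^ n * psi z))) +i*
    (\int[mu]_z (a z * complex.Im (val z ^ n * psi z))))%C.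
  by congr (_ +i* _)%C; apply: eq_Rintegral => z _; rewrite mulrCA;
    case: (val z ^ n * psi z) => x y /=; ring.
have b0 k : Cintegral mu (fun z => val z ^ n * ((b k z)%:C%C * psi z)) = 0.
  by have [_ _ bk] := mb k; have [_] := bk _ mpsi.
have [jr ji] := cintegrable_zX n ipsi.
have mbk k : measurable_fun setT (b k) by case: (mb k).
rewrite nE; apply/eqP; rewrite eq_complex/=; apply/andP; split; apply/eqP.
  apply: (Rintegral_bounded_lim0 mbk bM bB jr) => k.
  by have := b0 k; rewrite nE => -[].
apply: (Rintegral_bounded_lim0 mbk bM bB ji) => k.
by have := b0 k; rewrite nE => -[].
Qed.

(** The exponential series converges boundedly on bounded functions. *)
Lemma multiplier_expR b : multiplier b -> multiplier (fun z => expR (b z)).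
Proof.
move=> mb; have [_ [M bM] _] := mb.
have M0 (z : circle R) : 0 <= M by rewrite (le_trans _ (bM z)).
apply: (@multiplier_lim (fun n z => series (exp_coeff (b z)) n) _ (expR M)).
- elim=> [|n IH].
    rewrite (_ : (fun _ => _) = (fun=> 0)); first exact: multiplier_cst.
    by apply/funext => z; rewrite /series/= big_geq.
  rewrite (_ : (fun _ => _) =
    (fun z => series (exp_coeff (b z)) n + (n`!%:R)^-1 * b z ^+ n)).
    by apply: multiplierD => //; apply: multiplierZ; exact: multiplierX.
  by apply/funext => z; rewrite seriesSr/= [_^-1 * _]mulrC.
- move=> n z; apply: (@le_trans _ _ (series (exp_coeff M) n)).
    rewrite /series/= (le_trans (ler_norm_sum _ _ _))// ler_sum// => i _.
    rewrite /exp_coeff/= normrM normfV normrX [`|_%:R|]ger0_norm//.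
    by rewrite ler_wpM2r ?invr_ge0// lerXn2r ?nnegrE ?(M0 z).
  apply: nondecreasing_cvgn_le; last exact: is_cvg_series_exp_coeff.
  apply: nondecreasing_series => i _ _; exact/exp_coeff_ge0/(M0 z).
- by move=> z; exact: is_cvg_series_exp_coeff.
Qed.

End circle_moments.

Section fourier_uniqueness.
Context {R : realType}.
Local Notation mu := (@circle_measure R).
Implicit Types (psi : circle R -> R[i]) (b : circle R -> R) (A : set (circle R)).

Definition indic_multiplier A := multiplier (\1_A : circle R -> R).

Lemma expR_oppX_cvg (r : R) : 0 < r -> expR (- r ^+ n) @[n --> \oo] -->
  (if r < 1 then 1 else if r == 1 then expR (-1) else 0).
Proof.
move=> r0; case: ltP => [r1|]; last rewrite le_eqVlt => /orP[/eqP<-|r1].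
- rewrite -expR0 -oppr0; apply: (@cvg_comp _ _ _ (fun n => - r ^+ n) expR); last exact: continuous_expR.
  by apply: cvgN; apply: cvg_expr; rewrite ger0_norm// ltW.
- by rewrite eqxx; under eq_cvg do rewrite expr1n; exact: cvg_cst.
rewrite gt_eqF//.
apply: (@squeeze_cvgr _ _ _ _ (fun=> 0) (fun n => r^-1 ^+ n)).
- apply: nearW => n; rewrite expR_ge0/= expRN exprVn lef_pV2 ?posrE ?expR_gt0 ?exprn_gt0//.
  by rewrite (le_trans _ (expR_ge1Dx _))// lerDr.
- exact: cvg_cst.
by apply: cvg_expr; rewrite ger0_norm ?invr_ge0 ?ltW// invf_lt1.
Qed.

(** With [r] positive, bounded, and [r z < 1] exactly when [b z < a], the
    functions [exp (- r ^ n)] tend to [1], [exp (-1)] or [0] according to the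
    sign of [b z - a]; the powers of this limit then tend to the indicator of
    the ray. *)
Lemma indic_multiplier_ray b (a : R) :
  multiplier b -> indic_multiplier [set z | b z < a].
Proof.
move=> mb; have [_ [M bM] _] := mb.
pose c := `|M| + `|a| + 1; pose r z := 1 + (2 * c)^-1 * (b z - a).
have c0 : 0 < c by rewrite ltr_wpDl// addr_ge0.
have r0 z : 0 < r z.
  have : - c < b z - a.
    have := bM z; rewrite ler_norml => /andP[+ _]; rewrite /c.
    by have := ler_norm a; have := ler_norm M; lra.
  move=> cb; rewrite /r -ltrBlDl sub0r [_^-1 * _]mulrC ltr_pdivlMr ?mulr_gt0//.
  by lra.
have r1 z : (r z < 1) = (b z < a).
  by rewrite /r -ltrBrDl subrr pmulr_rlt0 ?invr_gt0 ?mulr_gt0// subr_lt0.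
have mr : multiplier r.
  apply: multiplierD; first exact: multiplier_cst.
  by apply: multiplierZ; apply: multiplierD => //; exact: multiplier_cst.
pose G (z : circle R) : R := if r z < 1 then 1 else if r z == 1 then expR (-1) else 0.
have e1 : expR (-1 : R) < 1 by rewrite expR_lt1 ltrN10.
have mG : multiplier G.
  apply: (@multiplier_lim _ (fun n (z : circle R) => expR (- r z ^+ n)) _ 1).
  - move=> n; apply: multiplier_expR.
    by under eq_fun do rewrite -mulN1r; apply: multiplierZ; exact: multiplierX.
  - move=> n z; rewrite ger0_norm ?expR_ge0// -[leRHS]expR0 ler_expR oppr_le0.
    by rewrite exprn_ge0// ltW.
  - by move=> z; exact: expR_oppX_cvg.
have G01 z : 0 <= G z <= 1.
  rewrite /G; case: ifP => _; first by rewrite ler01 lexx.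
  by case: ifP => _; rewrite ?lexx ?ler01// expR_ge0 ltW.
apply: (@multiplier_lim _ (fun n (z : circle R) => G z ^+ n.+1) _ 1).
- by move=> n; exact: multiplierX.
- by move=> n z; have /andP[G0 G1] := G01 z; rewrite normrX ger0_norm// exprn_ile1.
move=> z; rewrite indicE /G; have [bza|bza] := boolP (b z < a).
  rewrite r1 bza mem_set//; under eq_cvg do rewrite expr1n; exact: cvg_cst.
rewrite r1 (negbTE bza) memNset; last exact/negP.
case: ifP => _; last by under eq_cvg do rewrite expr0n; exact: cvg_cst.
rewrite (cvg_shiftS (fun n => expR (-1) ^+ n)); apply: cvg_expr.
by rewrite ger0_norm ?expR_ge0.
Qed.

(** Countable unions are limits of [1 - \prod_(k < n) (1 - \1_(F k))]. *)
Lemma sigma_algebra_indic_multiplier (U : Type) (h : circle R -> U) :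
  sigma_algebra setT [set A | indic_multiplier (h @^-1` A)].
Proof.
have C A : indic_multiplier A -> multiplier (fun z => 1 + -1 * (\1_A z : R)).
  by move=> mA; apply: multiplierD; [exact: multiplier_cst|exact: multiplierZ].
split=> /=.
- rewrite preimage_set0 /indic_multiplier indic0; exact: multiplier_cst.
- move=> A /C; congr multiplier; apply/funext => z; rewrite !indicE setTD.
  by rewrite preimage_setC in_setC; case: (_ \in _); rewrite /= ?mulr1 ?mulr0 ?subrr ?addr0.
move=> F mF.
pose p n z : R := \prod_(k < n) (1 + -1 * \1_(h @^-1` F k) z).
have mp n : multiplier (p n).
  elim: n => [|n IH].
    by rewrite (_ : p 0%N = fun=> 1); [exact: multiplier_cst|apply/funext => z; rewrite /p big_ord0].
  rewrite (_ : p n.+1 = fun z => p n z * (1 + -1 * \1_(h @^-1` F n) z)); last first.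
    by apply/funext => z; rewrite /p big_ord_recr.
  by apply: multiplierM => //; exact: C.
have pE n z : p n z = (~~ [exists k : 'I_n, z \in h @^-1` F k])%:R.
  rewrite /p; case: existsP => [[k zk]|nz].
    by rewrite (bigD1 k)//= indicE zk mulr1 subrr mul0r.
  rewrite big1// => k _; rewrite indicE; case: (boolP (_ \in _)) => [zk|]; last by rewrite mulr0 addr0.
  by exfalso; apply: nz; exists k.
rewrite /indic_multiplier preimage_bigcup.
apply: (@multiplier_lim _ (fun n (z : circle R) => 1 + -1 * p n z) _ 1).
- by move=> n; apply: multiplierD; [exact: multiplier_cst|exact: multiplierZ].
- move=> n z; rewrite pE; case: [exists _, _]; rewrite /= ?mulr0 ?mulr1 ?addr0 ?subrr ?normr1//.
  by rewrite normr0.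
move=> z; rewrite indicE; have [/set_mem[k _ zk]|nz] := boolP (z \in _).
  apply: cvg_near_cst; exists k.+1 => // n /= kn.
  rewrite pE (_ : [exists _, _]) /= ?mulr0 ?addr0//.
  by apply/existsP; exists (Ordinal kn); rewrite /= inE.
apply: cvg_near_cst; apply: nearW => n; rewrite pE.
rewrite (_ : [exists _, _] = false) /= ?mulr1 ?subrr//.
apply/negbTE; apply: contra nz => /existsP[k /set_mem zk].
by apply/mem_set; exists k.
Qed.

Lemma measurable_indic_multiplier A : measurable A -> indic_multiplier A.
Proof.
have ray b (B : set R) : multiplier b -> measurable B -> indic_multiplier (b @^-1` B).
  move=> mb; have mE : @measurable _ R = <<s @RGenInftyO.G R >> :=
    RGenInftyO.measurableE R.
  rewrite mE; move: B.
  apply: smallest_sub; first exact: sigma_algebra_indic_multiplier.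
  move=> _ [a ->] /=; rewrite (_ : b @^-1` _ = [set z | b z < a]).
    exact: indic_multiplier_ray.
  by apply/seteqP; split=> z /=; rewrite in_itv.
move=> [B mB <-]; rewrite setTI; move: B mB.
rewrite measurable_prod_measurableType.
apply: smallest_sub; first exact: sigma_algebra_indic_multiplier.
move=> _ [B1 mB1 [B2 mB2 <-]].
have := multiplierM (ray _ _ multiplier_Re mB1) (ray _ _ multiplier_Im mB2).
congr multiplier; apply/funext => z; rewrite -[LHS]/((\1__ \* \1__) z) -indicI.
by [].
Qed.

Lemma Rintegral_null (f : circle R -> R) : rintegrable mu f ->
  (forall A, measurable A -> \int[mu]_z (\1_A z * f z) = 0) ->
  {ae mu, forall z, f z = 0}.
Proof.
move=> fi f0; have mf := rintegrable_measurable fi.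
pose A := [set z | 0 <= f z].
have mA : measurable A.
  rewrite -[A]setTI; exact: measurable_fun_le (measurable_cst _) mf.
have nf : \int[mu]_z `|f z| = 0.
  rewrite (_ : (fun z => `|f z|) = (fun z => 2 * (\1_A z * f z) - \1_setT z * f z)); last first.
    apply/funext => z; rewrite indicT mul1r indicE /A.
    rewrite (_ : (z \in _) = (0 <= f z)); last by apply/idP/idP; rewrite inE.
    by case: (leP 0 (f z)) => fz; [rewrite ger0_norm|rewrite ltr0_norm]=> //=; ring.
  have iA B : measurable B -> rintegrable mu (fun z => \1_B z * f z).
    move=> mB; apply: (@rintegrableM _ _ _ _ _ 1) => //.
    by move=> z; rewrite indicE; case: (_ \in _); rewrite ?normr1 ?normr0.
  rewrite RintegralB//; [|by apply: rintegrableZ; exact: iA|exact: iA].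
  by rewrite RintegralZl ?f0 ?mulr0 ?subrr//; exact: iA.
have : (\int[mu]_z `|(f z)%:E| = 0)%E.
  rewrite -[LHS]fineK; first by congr EFin; exact: nf.
  by apply: integrable_fin_num => //; have := integrable_abse fi.
move/ae_eq_integral_abs => /(_ measurableT) f00.
have {f00} := f00 (measurable_int _ fi).
by apply: filterS => z /= /(_ Logic.I)[].
Qed.

(** Uniqueness of Fourier coefficients: by [measurable_indic_multiplier] the
    integral of [psi] over every Borel set is a zeroth moment that vanishes. *)
Lemma moments0_ae0 psi : moments0 psi -> {ae mu, forall z, psi z = 0}.
Proof.
move=> mpsi; have [[ir ii] _] := mpsi.
have A0 A : measurable A ->
    Cintegral mu (fun z => (\1_A z)%:C%C * psi z) = 0.
  move=> /measurable_indic_multiplier[_ _ /(_ _ mpsi)[_ /(_ 0) <-]].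
  by apply: eq_Cintegral => z; rewrite expr0z mul1r.
have r0 : {ae mu, forall z, complex.Re (psi z) = 0}.
  apply: Rintegral_null => // A /A0[+ _]; apply: etrans.
  by apply: eq_Rintegral => z _; case: (psi z) => x y/=; ring.
have i0 : {ae mu, forall z, complex.Im (psi z) = 0}.
  apply: Rintegral_null => // A /A0[_ +]; apply: etrans.
  by apply: eq_Rintegral => z _; case: (psi z) => x y/=; ring.
by apply: filterS2 r0 i0 => z; case: (psi z) => x y /= -> ->.
Qed.

End fourier_uniqueness.

(** * The Riesz-Fischer theorem *)

Lemma half_small (R : realType) (M e : R) : 0 <= M -> 0 < e ->
  exists m, forall n, (m <= n)%N -> 2 / 2 ^+ n * M < e.
Proof.
move=> M0 e0; have M1 : 0 < 2 * M + 1 by rewrite ltr_wpDl// mulr_ge0.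
have [m] := @ltr_add_invr R 0 (e / (2 * M + 1)) (divr_gt0 e0 M1); rewrite add0r => me.
exists m => n mn; rewrite mulrAC ltr_pdivrMr ?exprn_gt0//.
move: me; rewrite ltr_pdivlMr// mulrC ltr_pdivrMr// => me.
rewrite (lt_le_trans (y := 2 * M + 1)) ?ltrDl// (le_trans (ltW me))// ler_wpM2l ?(ltW e0)//.
by rewrite -natrX ler_nat (leq_trans _ (ltn_expl n (ltnSn 1))).
Qed.

Section riesz_fischer.
Context {R : realType} (K : sepHilbertType R).

Lemma sepHilbert_complete (u : nat -> K) : cauchy_sqnorm u ->
  exists l, (u n @[n --> \oo] --> l) /\ cvg_sqnorm u l.
Proof.
move=> cu; have cvu : cvgn u.
  apply: cauchy_cvg; apply: cauchy_exP => eps eps0.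
  have re0 : 0 < complex.Re eps by rewrite -ltcR RRe_real// gtr0_real.
  have [|N NP] := cu (complex.Re eps ^+ 2); first by rewrite exprn_gt0.
  exists (u N); exists N => // n /= Nn; rewrite -ball_normE/=.
  by rewrite -[eps]RRe_real ?gtr0_real// ltr_norm_sqnorm// NP.
exists (limn u); split=> // e e0.
have se0 : 0 < Num.sqrt e by rewrite sqrtr_gt0.
have /cvgrPdist_lt/(_ (Num.sqrt e)%:C%C) : u n @[n --> \oo] --> limn u by [].
rewrite ltcR => /(_ se0)[N _ NP]; exists N => n Nn.
by have := NP n Nn; rewrite ltr_norm_sqnorm// sqr_sqrtr ?ltW// sqnormBC.
Qed.

Lemma exists_dense_seq : exists s : nat -> K,
  forall (y : K) (e : R), 0 < e -> exists k, sqnorm (y - s k) < e.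
Proof.
have [D cD dD] := @separable R K.
have [y0 [_ Dy0]] := dD setT (ex_intro _ 0 Logic.I) openT.
have /pfcard_geP[D0|[s]] := cD; first by rewrite D0 in Dy0.
exists s => y e e0; have : closure D y.
  move=> B nB; have [v [Bv Dv]] := dD B° (ex_intro _ y nB) (open_interior B).
  by exists v; split=> //; exact: interior_subset.
move=> /closureP/(_ _ e0)[v Dv yv]; have [k _ kv] := @surj _ _ _ _ s v Dv.
by exists k; rewrite kv.
Qed.

Context d (T : measurableType d) (mu : {measure set T -> \bar R}).
Implicit Types (f : T -> K) (F G : L2 mu K).

(** In a separable space the balls around a dense sequence suffice to test
    Borel measurability, which thereby passes to pointwise limits. *)
Lemma borel_fun_sqnorm_dist f :
  (forall y, measurable_fun setT (fun x => sqnorm (f x - y))) -> borel_fun f.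
Proof.
move=> mf; apply/borel_funP => U oU.
have [s sP] := exists_dense_seq.
pose r (n : nat) : R := n.+1%:R^-1.
have -> : f @^-1` U = \bigcup_k \bigcup_(n in [set n |
    [set v | sqnorm (v - s k) < r n] `<=` U]) [set x | sqnorm (f x - s k) < r n].
  apply/seteqP; split=> [x Ux|x [k _ [n /= + fx]]]; last exact.
  have /nbhs_ballP[e /= e0 eU] : nbhs (f x) U by apply: open_nbhs_nbhs.
  have re0 : 0 < complex.Re e by rewrite -ltcR RRe_real// gtr0_real.
  have e40 : 0 < complex.Re e ^+ 2 / 4 by rewrite divr_gt0// exprn_gt0.
  have [n /(_ n (leqnn n)) ne] := inv_succ_small e40.
  have rn0 : 0 < r n by rewrite invr_gt0.
  have [k fk] := sP (f x) (r n) rn0.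
  exists k => //; exists n => //= v /= vk.
  apply: eU; rewrite -ball_normE/= -[e]RRe_real ?gtr0_real//.
  rewrite ltr_norm_sqnorm// -[f x](subrK (s k)) -addrA.
  rewrite (le_lt_trans (le_sqnormD _ _))// [sqnorm (s k - v)]sqnormBC.
  by move: vk fk; rewrite -/(r n) in ne; lra.
apply: bigcupT_measurable => k; apply: bigcup_measurable => n _.
have := mf (s k) measurableT _ (measurable_itv `]-oo, r n[); rewrite setTI.
rewrite (_ : _ @^-1` _ = [set x | sqnorm (f x - s k) < r n])//.
Qed.

Lemma L2_sqnormE F : (sqnorm F)%:E = (\int[mu]_x (sqnorm (L2_eval F x))%:E)%E.
Proof.
rewrite sqnormE L2_innerE /Cintegral/= /Rintegral.
under eq_integral do rewrite -sqnormE.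
by rewrite fineK// integrable_fin_num//; exact: sqnorm_integrable (L2_evalP F).
Qed.

(** The weights [4 ^+ k] absorb the factors [2] of [le_sqnormD], which replaces
    the triangle inequality. *)
Lemma telescope_sqnorm (f : nat -> K) m p :
  sqnorm (f (m + p)%N - f m) <=
  2 / 2 ^+ m * \sum_(m <= k < m + p) 4 ^+ k * sqnorm (f k.+1 - f k).
Proof.
elim: p m => [|p IH] m; first by rewrite addn0 subrr sqnorm0 big_geq// mulr0.
rewrite -[f (m + _)%N](subrK (f m.+1)) -addrA (le_trans (le_sqnormD _ _))//.
rewrite addnS -addSn big_ltn ?ltn_addr//.
have := IH m.+1; set s := \sum_(_ <= _ < _) _; set a := sqnorm (f _ - f m.+1).
set b := sqnorm _ => ab.
have -> : 2 / 2 ^+ m * (4 ^+ m * b + s) = 2 * (2 ^+ m * b) + 2 / 2 ^+ m * s.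
  rewrite (_ : 4 = 2 * 2); last by ring.
  by rewrite exprMn; field; rewrite expf_neq0// pnatr_eq0.
have : b <= 2 ^+ m * b by rewrite ler_peMl ?sqnorm_ge0// exprn_ege1// ler1n.
have : 2 * (2 / 2 ^+ m.+1 * s) = 2 / 2 ^+ m * s.
  by rewrite exprS; field; rewrite expf_neq0// pnatr_eq0.
lra.
Qed.

Lemma fast_subseq (u : nat -> L2 mu K) : cauchy_sqnorm u ->
  exists phi : nat -> nat,
    (forall k n, (phi k <= n)%N -> sqnorm (u (phi k) - u n) < (8 ^+ k)^-1) /\
    (forall k, (phi k <= phi k.+1)%N).
Proof.
move=> cu; have /choice[psi psiP] : forall k, exists N, forall m n,
    (N <= m)%N -> (N <= n)%N -> sqnorm (u m - u n) < (8 ^+ k)^-1.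
  by move=> k; apply: cu; rewrite invr_gt0 exprn_gt0.
exists (fun k => \sum_(i < k.+1) psi i)%N; split=> [k n kn|k].
  apply: psiP; first by rewrite big_ord_recr/= leq_addl.
  by rewrite (leq_trans _ kn)// big_ord_recr/= leq_addl.
by rewrite [leqRHS]big_ord_recr/= leq_addr.
Qed.

Lemma borel_funB f g : borel_fun f -> borel_fun g -> borel_fun (fun x => f x - g x).
Proof.
move=> mf mg; apply: (@borel_funD _ _ _ _ f (fun x => - g x)) => //.
rewrite (_ : (fun x => - g x) = (-1) \*: g); first exact: borel_funZ.
by apply/funext => x /=; rewrite scaleN1r.
Qed.

Lemma measurable_sqnorm_dist f y :
  borel_fun f -> measurable_fun setT (fun x => sqnorm (f x - y)).
Proof.
by move=> mf; exact: (borel_fun_sqnorm (borel_funB mf (borel_fun_cst y))).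
Qed.

Section fast_sequence.
Variable v : nat -> L2 mu K.
Hypothesis vfast : forall k, sqnorm (v k.+1 - v k) < (8 ^+ k)^-1.

(* [C] has integral at most [2]. Where it is finite, [telescope_sqnorm] makes
   [f k x] a Cauchy sequence; elsewhere, on the null set outside [E], the
   sequence is replaced by [0], and [fine] turns [C] into [0]. *)
Let f k := L2_eval (v k).
Let a k x : R := 4 ^+ k * sqnorm (f k.+1 x - f k x).
Let C x : \bar R := (\sum_(0 <= k <oo) (a k x)%:E)%E.

Let mf k : borel_fun (f k).
Proof. exact: borel_fun_L2_eval. Qed.

Let a0 k x : (0 <= (a k x)%:E)%E.
Proof. by rewrite lee_fin mulr_ge0 ?sqnorm_ge0// exprn_ge0. Qed.

Let ma k : measurable_fun setT (fun x => (a k x)%:E).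
Proof.
apply/measurable_EFinP; apply: measurable_funM => //.
exact: (borel_fun_sqnorm (borel_funB (mf _) (mf _))).
Qed.

Let C0 x : (0 <= C x)%E.
Proof. by apply: nneseries_ge0 => k _ _; exact: a0. Qed.

Let mC : measurable_fun setT C.
Proof. by apply: ge0_emeasurable_sum => k *; [exact: a0|exact: ma]. Qed.

Let int_sqnorm_diff k m :
  (\int[mu]_x (sqnorm (f k x - f m x))%:E = (sqnorm (v k - v m))%:E)%E.
Proof.
rewrite L2_sqnormE; apply: ae_eq_integral => //.
- apply/measurable_EFinP; exact: (borel_fun_sqnorm (borel_funB (mf _) (mf _))).
- apply/measurable_EFinP; exact: (borel_fun_sqnorm (borel_fun_L2_eval _)).
apply: filterS2 (L2_evalD (v k) (- v m)) (L2_evalZ (-1) (v m)) => x.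
by rewrite !scaleN1r => -> -> _.
Qed.

Let intC : (\int[mu]_x C x <= 2%:E)%E.
Proof.
rewrite integral_nneseries//; apply: lime_le.
  by apply: is_cvg_nneseries => k _ _; apply: integral_ge0 => x _; exact: a0.
apply: nearW => n; apply: (@le_trans _ _ (\sum_(0 <= k < n) (2 ^- k)%:E)%E).
  apply: lee_sum => k _; rewrite /a; under eq_integral do rewrite EFinM.
  rewrite ge0_integralZl//; last 2 first.
  - by apply/measurable_EFinP; exact: (borel_fun_sqnorm (borel_funB (mf _) (mf _))).
  - by move=> x _; rewrite lee_fin sqnorm_ge0.
  rewrite int_sqnorm_diff -EFinM lee_fin.
  rewrite -ler_pdivlMl ?exprn_gt0// (le_trans (ltW (vfast k)))//.
  rewrite -invfM -exprMn (_ : 4 * 2 = 8)//; ring.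
rewrite sumEFin lee_fin.
have -> : \sum_(0 <= k < n) 2 ^- k = 2 - 2 * 2 ^- n :> R.
  elim: n => [|n IH]; first by rewrite big_geq// expr0 invr1 mulr1 subrr.
  by rewrite big_nat_recr//= IH exprS; field; rewrite expf_neq0// pnatr_eq0.
by rewrite lerBlDr lerDl mulr_ge0// invr_ge0 exprn_ge0.
Qed.

Let iC : mu.-integrable setT C.
Proof.
apply/integrableP; split=> //.
under eq_integral do rewrite gee0_abs//.
by rewrite (le_lt_trans intC)// ltry.
Qed.

Let E := [set x | C x \is a fin_num].

Let mE : measurable E.
Proof. by rewrite -[E]setTI; exact: emeasurable_fin_num. Qed.

Let f' k x := if x \in E then f k x else 0.
Let c x : R := fine (C x).

Let mf' k : borel_fun (f' k).
Proof.
apply: measurable_fun_ifT => //.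
  apply: (measurable_fun_bool true); rewrite setTI (_ : _ @^-1` _ = E)//.
  by apply/seteqP; split=> x /=; [move=> /set_mem|move=> Ex; exact: mem_set].
exact: mf.
Qed.

Let c_ge0 x : 0 <= c x.
Proof. by rewrite /c fine_ge0. Qed.

Let f'_fast m p x : sqnorm (f' (m + p)%N x - f' m x) <= 2 / 2 ^+ m * c x.
Proof.
rewrite /f' /c; have [/set_mem xE|_] := boolP (x \in E); last first.
  by rewrite subrr sqnorm0 mulr_ge0 ?c_ge0 ?divr_ge0 ?exprn_ge0.
rewrite (le_trans (telescope_sqnorm (fun k => f k x) m p))//.
rewrite ler_wpM2l ?divr_ge0 ?exprn_ge0//.
rewrite -lee_fin fineK// -sumEFin.
apply: (@le_trans _ _ (\sum_(0 <= k < m + p) (a k x)%:E)%E); last first.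
  by apply: nneseries_lim_ge => k _ _; exact: a0.
rewrite [leRHS](@big_cat_nat _ _ _ m)//= ?leq_addr// leeDr// sume_ge0// => k _.
Qed.

Let f'_cvg x : exists l, (f' n x @[n --> \oo] --> l) /\ cvg_sqnorm (fun n => f' n x) l.
Proof.
apply: sepHilbert_complete => e e0.
have [|m mP] := half_small (c_ge0 x) (_ : 0 < e / 4); first by rewrite divr_gt0.
exists m => i j mi mj.
rewrite -[f' i x](subrK (f' m x)) -addrA (le_lt_trans (le_sqnormD _ _))//.
rewrite [sqnorm (f' m x - _)]sqnormBC.
have := f'_fast m (i - m) x; have := f'_fast m (j - m) x; rewrite !subnKC//.
by have := mP m (leqnn m); lra.
Qed.

(** The pointwise limit [l] satisfies [sqnorm (l x - f' m x) <= 4 / 2 ^+ m * c x]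
    with [c] integrable, which gives both its square-integrability and the
    convergence in norm. *)
Lemma fast_sequence_cvg : exists L, cvg_sqnorm v L.
Proof.
have /choice[l lP] := f'_cvg.
have lc m x : sqnorm (l x - f' m x) <= 4 / 2 ^+ m * c x.
  apply/ler_addgt0Pr => e e0.
  have [|N NP] := (lP x).2 (e / 2); first by rewrite divr_gt0.
  rewrite -[l x](subrK (f' (m + N)%N x)) -addrA (le_trans (le_sqnormD _ _))//.
  have := NP (m + N)%N (leq_addl _ _); rewrite sqnormBC.
  have := f'_fast m N x; set t := c x; set w := 2 ^+ m.
  have -> : 4 / w * t = 2 * (2 / w * t) by rewrite !mulrA -natrM.
  lra.
have ml : borel_fun l.
  apply: borel_fun_sqnorm_dist => y.
  apply: (@measurable_fun_cvg _ _ _ setT (fun n x => sqnorm (f' n x - y))) => //.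
    by move=> n; exact: measurable_sqnorm_dist.
  move=> x _; apply: continuous_cvg; first exact: sqnorm_continuous.
  by apply: cvgB; [exact: (lP x).1|exact: cvg_cst].
have mc : measurable_fun setT c by exact: measurableT_comp.
have intc : (\int[mu]_x (c x)%:E <= 2%:E)%E.
  apply: le_trans intC; apply: ge0_le_integral => //.
  - by move=> x _; rewrite lee_fin.
  - exact/measurable_EFinP.
  by move=> x _; rewrite /c; have := C0 x; case: (C x) => [r| |]//= _; rewrite ?leey.
have aef k : {ae mu, forall x, f' k x = f k x}.
  apply: filterS (integrable_ae measurableT iC) => x /(_ Logic.I) xE.
  by rewrite /f' mem_set.
have lL : l \in L2_pred mu K.
  have ig : rintegrable mu (fun x => 8 * c x + 2 * sqnorm (f 0 x)).
    apply: rintegrableD; apply: rintegrableZ; last first.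
      exact: (sqnorm_integrable (L2_evalP (v 0))).
    apply/integrableP; split; first exact/measurable_EFinP.
    under eq_integral do rewrite gee0_abs ?lee_fin//.
    by rewrite (le_lt_trans intc)// ltry.
  apply/L2_predP; split=> //; apply: le_lt_trans (integrableP _ _ _ ig).2.
  apply: ge0_le_integral => //.
  - by move=> x _; rewrite lee_fin sqnorm_ge0.
  - exact/measurable_EFinP/borel_fun_sqnorm.
  - by apply: measurableT_comp => //; exact: (integrableP _ _ _ ig).1.
  move=> x _; rewrite lee_fin; apply: le_trans (ler_norm _).
  rewrite -[l x](subrK (f' 0 x)) (le_trans (le_sqnormD _ _))//.
  have := lc 0%N x; rewrite expr0 divr1.
  have : sqnorm (f' 0 x) <= sqnorm (f 0 x).
    by rewrite /f'; case: ifP => // _; rewrite sqnorm0 sqnorm_ge0.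
  lra.
exists (mkL2 lL) => e e0.
have [|m mP] := half_small (_ : 0 <= 4) e0; first by [].
exists m => n mn; rewrite (le_lt_trans _ (mP n mn))// -lee_fin L2_sqnormE.
apply: (@le_trans _ _ (\int[mu]_x (4 / 2 ^+ n * c x)%:E)%E); last first.
  under eq_integral do rewrite EFinM.
  rewrite ge0_integralZl//; last 2 first.
  - exact/measurable_EFinP.
  - by move=> x _; rewrite lee_fin.
  apply: (@le_trans _ _ ((4 / 2 ^+ n)%:E * 2%:E)%E).
    by rewrite lee_pmul2l// lte_fin divr_gt0// exprn_gt0.
  by rewrite -EFinM lee_fin mulrAC [leRHS]mulrAC -natrM -natrM.
have -> : (\int[mu]_x (sqnorm (L2_eval (v n - mkL2 lL) x))%:E =
           \int[mu]_x (sqnorm (l x - f' n x))%:E)%E.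
  apply: ae_eq_integral => //.
  - by apply/measurable_EFinP; exact: (borel_fun_sqnorm (borel_fun_L2_eval _)).
  - by apply/measurable_EFinP; exact: (borel_fun_sqnorm (borel_funB ml (mf' _))).
  apply: filterS2 (aef n) (filterI (L2_eval_mkL2 lL)
    (filterI (L2_evalD (v n) (- mkL2 lL)) (L2_evalZ (-1) (mkL2 lL)))) => x fx [Lx [+ +]] _.
  by rewrite !scaleN1r => -> ->; rewrite Lx sqnormBC fx.
apply: ge0_le_integral => //.
- by move=> x _; rewrite lee_fin sqnorm_ge0.
- by apply/measurable_EFinP; exact: (borel_fun_sqnorm (borel_funB ml (mf' _))).
- by apply/measurable_EFinP; apply: measurable_funM.
- by move=> x _; rewrite lee_fin; exact: lc.
Qed.

End fast_sequence.

(** Riesz-Fischer: a Cauchy sequence has a fast subsequence, and converges to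
    the limit of that subsequence. *)
Lemma L2_complete : complete_set [set: L2 mu K].
Proof.
move=> u _ cu; have [phi [fast mono]] := fast_subseq cu.
have [|L vL] := @fast_sequence_cvg (u \o phi).
  by move=> k; rewrite sqnormBC; exact: fast.
exists L; first exact: Logic.I.
move=> e e0.
have [|N NP] := vL (e / 4); first by rewrite divr_gt0.
have [|k kP] := half_small ler01 (_ : 0 < e / 4); first by rewrite divr_gt0.
pose m := maxn N k; exists (phi m) => n mn.
rewrite -[u n](subrK (u (phi m))) -addrA (le_lt_trans (le_sqnormD _ _))//.
rewrite [sqnorm (u n - _)]sqnormBC.
have := NP m (leq_maxl _ _); have := fast m n mn; rewrite /=.
have := kP m (leq_maxr _ _); rewrite mulr1.
have : (8 ^+ m)^-1 <= 2 / 2 ^+ m :> R.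
  rewrite ler_pdivlMr ?exprn_gt0// mulrC ler_pdivrMr ?exprn_gt0//.
  rewrite (@le_trans _ _ (8 ^+ m))//; first by rewrite lerXn2r ?nnegrE// ler_nat.
  by rewrite ler_peMl ?exprn_ge0// ler1n.
lra.
Qed.
End riesz_fischer.

(** * Optimality of linearly independent Parseval generators *)

Section optimality.
Context {R : realType} {V : innerType R}.
Implicit Types (N : set V) (f g : V).

Lemma lin_indep_neq0 (J : choiceType) (v : J -> V) :
  lin_indep v -> forall j, v j != 0.
Proof.
move=> lv j; apply/eqP => vj0.
have := lv [:: j] (fun=> 1) isT; rewrite big_seq1 scale1r => /(_ vj0 j).
by rewrite mem_head => /(_ isT)/eqP; rewrite oner_eq0.
Qed.

Lemma lin_indep_inj (J : choiceType) (v : J -> V) m (h : 'I_m -> J)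
    (c : 'I_m -> R[i]) :
  lin_indep v -> injective h -> \sum_a c a *: v (h a) = 0 -> forall a, c a = 0.
Proof.
move=> lv ih c0 a; pose c' j := \sum_(b | h b == j) c b.
have c'E b : c' (h b) = c b by rewrite /c' (big_pred1 b)// => b'; rewrite (inj_eq ih).
rewrite -c'E; apply: (lv [seq h b | b <- enum 'I_m]) => //.
- by rewrite map_inj_uniq ?enum_uniq.
- by rewrite big_map big_enum/= -[RHS]c0; apply: eq_bigr => b _; rewrite c'E.
by rewrite map_f// mem_enum.
Qed.

Lemma reindex_parseval_generators N (A : V -> V) (I J : choiceType) (v : J -> V)
    (h : I -> J) : bijective h -> countable [set: I] ->
  parseval_generators N A v -> parseval_generators N A (v \o h).
Proof.
move=> [h' hK h'K] cI [cJ v0 [_ vN vP]]; split=> //; first by move=> i; exact: v0.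
split.
- by rewrite -setXTT; exact: countableX cI (countableP _).
- by move=> [i n]; exact: (vN (h i, n)).
move=> f Nf; rewrite -vP//.
rewrite (@reindex_esum R _ _ setT setT (fun p : I * nat => (h p.1, p.2)));
  first by apply: eq_esum => -[].
split=> //.
  by move=> [i n] [j m] _ _ /= [/(can_inj hK)-> ->].
by move=> [j n] _; exists (h' j, n) => //=; rewrite h'K.
Qed.

Section defect.
Context N (A B : V -> V).
Hypothesis sN : closed_subspace N.
Hypothesis BN : forall f, N f -> N (B f).
Hypothesis AB : forall f g, N f -> N g -> '[f, A g] = '[B f, g].

(** [B] being the adjoint of [A] on [N], the terms of positive order in the
    Parseval identity for [f] are those of the Parseval identity for [B f]. *)
Lemma parseval_generators_defect (I : choiceType) (v : I -> V) f :
  parseval_generators N A v -> N f ->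
  (\esum_(i in [set: I]) (csq '[f, v i])%:E + (sqnorm (B f))%:E =
   (sqnorm f)%:E)%E.
Proof.
move=> [_ _ [_ vN vP]] Nf.
have csq0 (z : R[i]) : (0 <= (csq z)%:E)%E by rewrite lee_fin csq_ge0.
rewrite -(vP f Nf) -(vP _ (BN Nf)).
rewrite [RHS](esumID [set p : I * nat | p.2 = 0%N]); last first.
  by move=> p _; rewrite Re_sqr_norm.
congr (_ + _)%E.
  rewrite (@reindex_esum R _ _ setT _ (fun i : I => (i, 0%N))).
    by apply: eq_esum => i _; rewrite Re_sqr_norm.
  split=> //; first by move=> i j _ _ [].
  by move=> [i n] [_ /= ->]; exists i.
rewrite (@reindex_esum R _ _ setT _ (fun p : I * nat => (p.1, p.2.+1))).
  by apply: eq_esum => -[i n] _ /=; rewrite AB//; exact: (vN (i, n)).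
split.
- by move=> [i n] _; split.
- by move=> [i n] [j m] _ _ /= [-> ->].
by move=> [i [|n]] [_ /= n0]; [case: n0|exists (i, n)].
Qed.

(** The defect [sqnorm f - sqnorm (B f)] does not depend on the generators. *)
Lemma parseval_generators_perp (I J : choiceType) (v : I -> V) (w : J -> V) f :
  parseval_generators N A v -> parseval_generators N A w -> N f ->
  (forall j, '[f, w j] = 0) -> forall i, '[f, v i] = 0.
Proof.
move=> vg wg Nf fw i.
have := parseval_generators_defect wg Nf.
rewrite -(parseval_generators_defect vg Nf) => /(congr1 (fun x => (x - (sqnorm (B f))%:E)%E)).
rewrite !addeK// esum1; last by move=> j _; rewrite fw /csq/= expr0n addr0.
move=> /esym v0; apply: csq_eq0; apply/eqP; rewrite eq_le csq_ge0 andbT.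
by have := @esum_ge_seq R I (fun i => csq '[f, v i]) [:: i] isT;
  rewrite big_seq1 v0 lee_fin.
Qed.

(** More than [d] of the [v j] have a nontrivial combination [f] orthogonal to
    the [d] vectors [w i], hence to all the [v j], hence to itself. *)
Lemma parseval_generators_size (J : choiceType) (v : J -> V) d (w : 'I_d -> V)
    (s : seq J) :
  parseval_generators N A v -> lin_indep v -> parseval_generators N A w ->
  uniq s -> (size s <= d)%N.
Proof.
move=> vg lv wg us; rewrite leqNgt; apply/negP => ds.
have vN j : N (v j) by case: vg => _ _ [_ + _]; move=> /(_ (j, 0%N)).
pose h (a : 'I_(size s)) := tnth (in_tuple s) a.
have ih : injective h by apply/tuple_uniqP.
pose G := \matrix_(a < size s, i < d) '[v (h a), w i].
have kG : kermx G != 0.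
  rewrite kermx_eq0; apply/negP => /eqP rG.
  by have := rank_leq_col G; rewrite rG leqNgt ds.
pose u := nz_row (kermx G).
have uG : u *m G = 0 by apply/sub_kermxP; exact: nz_row_sub.
have u0 : u != 0 by rewrite nz_row_eq0.
pose f := \sum_a u 0 a *: v (h a).
have Nf : N f by apply: (subspace_sum sN) => a; exact: subspaceZ.
have fw i : '[f, w i] = 0.
  have uGi : \sum_a u 0 a * G a i = 0.
    by have := congr1 (fun M : 'rV[R[i]]_d => M ord0 i) uG; rewrite !mxE.
  by apply: etrans uGi; rewrite inner_suml; apply: eq_bigr => a _; rewrite mxE innerZl.
have fv := parseval_generators_perp vg wg Nf fw.
have f0 : f = 0.
  apply: inner_self_eq0; rewrite {1}/f inner_suml big1// => a _.
  by rewrite innerZl (inner_eq0C (fv _)) mulr0.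
move/eqP: u0; apply; apply/rowP => a; rewrite mxE.
exact: (lin_indep_inj (c := fun a => u 0 a) lv ih f0).
Qed.

(** Linear independence alone gives optimality: by [parseval_generators_size]
    a finite generating system bounds the number of the [v j], so that either
    they are finitely many and the index is their number, or no finite
    generating system exists. *)
Lemma optimal_lin_indep (J : choiceType) (v : J -> V) :
  parseval_generators N A v -> lin_indep v -> optimal_parseval_generators N A v.
Proof.
move=> vg lv; split=> //; rewrite /parseval_index.
have seq_gens (s : seq J) : uniq s -> (forall j, j \in s) ->
    ([set: J] #= `I_(size s))%card /\
    exists w : 'I_(size s) -> V, parseval_generators N A w.
  move=> us sJ; split.
    apply/pcard_eqP; apply: squash.
    have /Pbij[//] : set_bij [set: J] `I_(size s) (fun j => index j s).
    split.
    - by move=> j _ /=; rewrite index_mem.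
    - by move=> j k _ _ jk; rewrite -(nth_index j (sJ j)) jk nth_index.
    - move=> n /= ns.
      case: s us sJ ns => // j0 s us sJ ns.
      by exists (nth j0 (j0 :: s) n) => //; exact: index_uniq.
  exists (v \o tnth (in_tuple s)); apply: reindex_parseval_generators => //;
    last exact: countableP.
  have js j : (index j s < size s)%N by rewrite index_mem.
  exists (fun j => Ordinal (js j)) => [a|j]; last by rewrite (tnth_nth j) nth_index.
  by apply: val_inj; rewrite /= (tnth_nth (tnth (in_tuple s) a)) index_uniq.
have [fin|nfin] := pselect (exists d, exists w : 'I_d -> V, parseval_generators N A w).
  rewrite /= asboolT//; have [d [w wg]] := fin.
  pose P n := `[< exists s : seq J, uniq s /\ size s = n >].
  (* A duplicate-free sequence of maximal length enumerates [J]. *)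
  have [||n /asboolP[s [us <-]] nmax] := @ex_maxnP P d.
  - by exists 0%N; apply/asboolP; exists [::].
  - by move=> n /asboolP[s [us <-]]; exact: (parseval_generators_size vg lv wg us).
  have sJ j : j \in s.
    apply: contraT => js; have := nmax (size s).+1; rewrite ltnn; apply.
    by apply/asboolP; exists (j :: s); rewrite /= js.
  have [cJ sg] := seq_gens s us sJ.
  rewrite (@xget_unique _ 0%N _ (size s))//.
    by split=> // d' [w' w'g]; exact: (parseval_generators_size vg lv w'g us).
  move=> d' [[w' w'g] /(_ (size s) sg) d's]; apply/eqP; rewrite eqn_leq d's/=.
  exact: (parseval_generators_size vg lv w'g us).
rewrite /= asboolF// asboolT; last by exists J, v.
apply/card_eqPle; split; first by case: vg.
apply/infiniteP => /finite_seqP [s sE].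
have [j|_ [w wg]] := seq_gens (undup s) (undup_uniq s).
  by rewrite mem_undup; have : [set: J] j by []; rewrite sE.
by apply: nfin; exists (size (undup s)), w.
Qed.

End defect.
End optimality.

(** * Orthogonal decompositions in a complete space *)

Section projections.
Context {R : realType} {V : innerType R}.
Hypothesis cV : complete_set [set: V].
Implicit Types (A B : set V) (f g h : V).

Lemma projection_exists A f : closed_subspace A ->
  exists2 g, A g & forall h, A h -> '[f - g, h] = 0.
Proof.
move=> sA; apply: exists_projection => //.
by apply: (closed_complete _ _ cV) => //; case: sA.
Qed.

Lemma ortho_projP A f : closed_subspace A ->
  A (ortho_proj A f) /\ forall h, A h -> '[f - ortho_proj A f, h] = 0.
Proof.
move=> sA; have [g Ag gP] := projection_exists f sA.
exact: (@xgetPex _ 0 [set g | A g /\ forall h, A h -> '[f - g, h] = 0]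
  (ex_intro _ g (conj Ag gP))).
Qed.

Lemma ortho_proj_inner A f h : closed_subspace A -> A h ->
  '[ortho_proj A f, h] = '[f, h].
Proof.
move=> sA Ah; have [_ /(_ _ Ah)/eqP] := ortho_projP f sA.
by rewrite innerBl subr_eq0 => /eqP.
Qed.

Lemma ominus_split A B f : closed_subspace A -> closed_subspace B -> B `<=` A ->
  A f -> exists2 g, B g & ominus A B (f - g).
Proof.
move=> sA sB BA Af; have [g Bg gP] := projection_exists f sB.
by exists g => //; split=> //; apply: (subspaceB sA) => //; exact: BA.
Qed.

(** What remains of [f] after projecting on [B] lies in the complement of [B],
    so it is orthogonal to [f] and to the projection, hence to itself. *)
Lemma ominusK A B f : closed_subspace A -> closed_subspace B -> B `<=` A ->
  A f -> (forall g, ominus A B g -> '[f, g] = 0) -> B f.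
Proof.
move=> sA sB BA Af fP; have [g Bg fg] := ominus_split sA sB BA Af.
have : '[f - g, f - g] = 0.
  by rewrite innerBl fP// (inner_eq0C (fg.2 _ Bg)) subr0.
by move/inner_self_eq0/eqP; rewrite subr_eq0 => /eqP ->.
Qed.

Lemma orthonormal_basis_perp A (I : choiceType) (x : I -> V) g :
  orthonormal_basis A x -> (forall i, '[g, x i] = 0) ->
  forall f, A f -> '[g, f] = 0.
Proof.
move=> [_ <-] gx f xf; apply: inner_eq0C.
apply: (closed_span_sub (closed_perp g)) xf => i /=.
exact: inner_eq0C.
Qed.

Lemma orthonormal_basis_mem A (I : choiceType) (x : I -> V) i :
  orthonormal_basis A x -> A (x i).
Proof. by move=> [_ <-]; exact: sub_closed_span. Qed.

(** The hypothesis is tested on [g = f - p], with [p] the projection of [f] on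
    the closed span of [x]: such a [g] is orthogonal to every [x i] and has the
    same inner products as [f] with the vectors orthogonal to every [x i]. *)
Lemma parseval_of_perp (I : choiceType) (x : I -> V) f :
  (forall i j, '[x i, x j] = (i == j)%:R) ->
  (forall g, (forall i, '[g, x i] = 0) ->
    (forall y, (forall i, '[y, x i] = 0) -> '[g, y] = '[f, y]) -> g = 0) ->
  \esum_(i in [set: I]) (csq '[f, x i])%:E = (sqnorm f)%:E.
Proof.
move=> ox fP; apply: orthonormal_parseval => //.
have sx := closed_span_subspace x.
have [p xp pP] := projection_exists f sx.
have /eqP : f - p = 0.
  apply: fP => [i|y yx]; first by apply: pP; exact: sub_closed_span.
  rewrite innerBl (_ : '[p, y] = 0) ?subr0//.
  apply: (closed_span_sub (closed_perp y)) xp => i /=.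
  exact: inner_eq0C.
by rewrite subr_eq0 => /eqP ->.
Qed.

(** By Bessel, at most finitely many [x i] have a coefficient on [D n] bounded
    below by a given [k.+1^-1]; no [x i] has all its coefficients zero. *)
Lemma orthonormal_countable (I : choiceType) (x : I -> V) (D : nat -> V) :
  (forall i j, '[x i, x j] = (i == j)%:R) ->
  (forall g, (forall n, '[g, D n] = 0) -> g = 0) -> countable [set: I].
Proof.
move=> ox Dtot.
pose big (p : nat * nat) := [set i | p.2.+1%:R^-1 < csq '[D p.1, x i]].
have finb p : finite_set (big p).
  apply: contrapT => /(infinite_set_fset
    (Num.truncn (sqnorm (D p.1) * p.2.+1%:R)).+1)[B Bbig sB].
  have := @Bessel _ _ _ x ox (finmap.enum_fset B) (D p.1) (finmap.fset_uniq B).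
  apply/negP; rewrite -ltNge.
  apply: (@lt_le_trans _ _ (\sum_(i <- finmap.enum_fset B) p.2.+1%:R^-1)).
    rewrite big_const_seq count_predT iter_addr_0 -[X in _ < X]mulr_natl.
    rewrite ltr_pdivlMr//; apply: lt_le_trans (truncnS_gt _) _.
    by rewrite ler_nat.
  by rewrite !big_seq; apply: ler_sum => i iB; exact/ltW/Bbig.
have -> : [set: I] = \bigcup_(p in [set: nat * nat]) big p.
  apply/seteqP; split=> // i _.
  have [n xDn] : exists n, '[x i, D n] <> 0.
    apply: contrapT => nD; have x0 : x i = 0.
      by apply: Dtot => n; apply: contrapT => xDn; apply: nD; exists n.
    by have := ox i i; rewrite x0 inner0l eqxx => /esym/eqP; rewrite oner_eq0.
  have c0 : 0 < csq '[D n, x i].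
    rewrite lt_neqAle csq_ge0 andbT eq_sym; apply/eqP => /csq_eq0/inner_eq0C.
    by [].
  have [k] := @ltr_add_invr R 0 _ c0; rewrite add0r => kc.
  by exists (n, k).
apply: bigcup_countable; first exact: countableP.
by move=> p _; exact: finite_set_countable.
Qed.

End projections.

(** * Wandering subspaces of an action of the integers *)

Section bilateral_shift.
Context {R : realType} {V : innerType R}.
Hypothesis cV : complete_set [set: V].
Variable T : int -> V -> V.
Hypothesis T0 : forall f, T 0 f = f.
Hypothesis TT : forall m n f, T (m + n) f = T m (T n f).
Hypothesis Tadj : forall n f g, '[T n f, g] = '[f, T (- n) g].
Variable C : set V.
Hypothesis sC : closed_subspace C.
Hypothesis Cwand : forall (n : int) c c', n != 0 -> C c -> C c' -> '[T n c, c'] = 0.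
Hypothesis Ctot : forall g, (forall n c, C c -> '[g, T n c] = 0) -> g = 0.
Implicit Types (A : set V) (f g h c w : V) (n : int).

Lemma inner_shift (m n : int) f g : '[T m f, T n g] = '[T (m - n) f, g].
Proof. by rewrite [m - n]addrC TT Tadj [RHS]Tadj opprK. Qed.

Lemma inner_shiftr n f g : '[f, T n g] = '[T (- n) f, g].
Proof. by rewrite -{1}[f]T0 inner_shift sub0r. Qed.

(** The Hardy space, when [T n] is the multiplication by [z ^ n] and [C] the
    space of constants. *)
Definition hardy_of : set V :=
  [set f | forall n, n < 0 -> forall c, C c -> '[f, T n c] = 0].

Lemma hardy_of_subspace : closed_subspace hardy_of.
Proof.
have -> : hardy_of =
    [set f | forall g, (exists n, n < 0 /\ exists2 c, C c & g = T n c) -> '[f, g] = 0].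
  apply/seteqP; split=> f fH; first by move=> _ [n [n0 [c Cc ->]]]; exact: fH.
  by move=> n n0 c Cc; apply: fH; exists n; split=> //; exists c.
exact: closed_bigperp.
Qed.

Let H := hardy_of.
Let sH := hardy_of_subspace.

Lemma hardy_of_shift f : H f -> H (T 1 f).
Proof.
move=> fH n n0 c Cc; rewrite Tadj -TT; apply: fH => //.
by rewrite addrC subr_lt0 (lt_trans n0).
Qed.

Lemma hardy_of_sub : C `<=` H.
Proof.
move=> c Cc n n0 c' Cc'; rewrite inner_shiftr Cwand// oppr_eq0.
by rewrite lt_eqF.
Qed.

Lemma inner_shift_cst f c : H f -> C c -> '[T 1 f, c] = 0.
Proof. by move=> fH Cc; rewrite Tadj; apply: fH. Qed.

(** Translates with different exponents are orthogonal because [A] is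
    wandering, those with the same exponent because [x] is orthonormal. *)
Lemma orthonormal_shifts A (I : choiceType) (x : I -> V) (s : nat -> int) :
  (forall n w w', n != 0 -> A w -> A w' -> '[T n w, w'] = 0) ->
  orthonormal_basis A x -> injective s ->
  forall p q : I * nat, '[T (s p.2) (x p.1), T (s q.2) (x q.1)] = (p == q)%:R.
Proof.
move=> Awand Ax is' [i m] [j n] /=; rewrite inner_shift xpair_eqE.
have [->|mn] := eqVneq m n; first by rewrite subrr T0 Ax.1 andbT.
rewrite andbF Awand//; try exact: orthonormal_basis_mem Ax.
by rewrite subr_eq0 (inj_eq is').
Qed.

(** The kernel of the backward shift consists of constants: what remains of [f]
    after removing its constant term is orthogonal to all translates of [C]. *)
Lemma hardy_of_constants f : H f -> (forall h, H h -> '[f, T 1 h] = 0) -> C f.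
Proof.
move=> Hf fT; have [p Cp pP] := projection_exists cV f sC.
suff /eqP : f - p = 0 by rewrite subr_eq0 => /eqP ->.
have Hfp : H (f - p) by apply: (subspaceB sH) => //; exact: hardy_of_sub.
apply: Ctot => n c Cc; case: (ltgtP n 0) => [n0|n0|->]; first exact: Hfp.
  rewrite innerBl (_ : '[p, _] = 0); last first.
    by rewrite inner_shiftr Cwand// oppr_eq0 gt_eqF.
  rewrite subr0; case: n n0 => // -[//|n] _.
  have HTc k : H (T k%:Z c).
    elim: k => [|k IH]; first by rewrite T0; exact: hardy_of_sub.
    by rewrite -addn1 addnC PoszD TT; exact: hardy_of_shift.
  by rewrite -addn1 addnC PoszD TT; apply: fT; exact: HTc.
by rewrite T0; exact: pP.
Qed.

Let B := adjoint_on H (T 1).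

(** The adjoint exists: it maps [f] to the projection of [T (-1) f] on [H]. *)
Lemma adjoint_shiftP f : H (B f) /\ forall h, H h -> '[T 1 h, f] = '[h, B f].
Proof.
have [g Hg gP] := projection_exists cV (T (- 1) f) sH.
apply: (@xgetPex _ 0 [set g | H g /\ forall h, H h -> '[T 1 h, f] = '[h, g]]).
exists g; split=> // h Hh; rewrite Tadj; apply/eqP; rewrite -subr_eq0 -innerBr.
by apply/eqP; apply: inner_eq0C; exact: gP.
Qed.

Lemma inner_adjoint_iter k f h : H f -> H h -> '[iter k B f, h] = '[f, T k%:Z h].
Proof.
move=> Hf; elim: k h => [|k IH] h Hh; first by rewrite T0.
rewrite iterS inner_conj -(adjoint_shiftP _).2// -inner_conj IH; last exact: hardy_of_shift.
by rewrite -TT -PoszD addn1.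
Qed.

Section model.
Variable N : set V.
Hypothesis NH : N `<=` H.
Hypothesis sN : closed_subspace N.
Hypothesis NB : forall f, N f -> N (B f).
Let M := ominus H N.
Let W := ominus M (T 1 @` M).
Let WC := W `&` C.
Let W1 := ominus W WC.
Let K1 := ominus C WC.
Let A f := ortho_proj N (T 1 f).

Let sM : closed_subspace M. Proof. exact: closed_ominus. Qed.
Let sW : closed_subspace W. Proof. exact: closed_ominus. Qed.
Let sWC : closed_subspace WC. Proof. exact: closed_subspaceI. Qed.
Let sW1 : closed_subspace W1. Proof. exact: closed_ominus. Qed.
Let sK1 : closed_subspace K1. Proof. exact: closed_ominus. Qed.

Let M_shift f : M f -> M (T 1 f).
Proof.
move=> [Hf fN]; split; first exact: hardy_of_shift.
by move=> g Ng; rewrite (adjoint_shiftP _).2//; apply/fN/NB.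
Qed.

Let M_shiftn k f : M f -> M (T (Posz k) f).
Proof.
move=> Mf; elim: k => [|k IH]; first by rewrite T0.
by rewrite -addn1 addnC PoszD TT; exact: M_shift.
Qed.

Let perp_M f : H f -> (forall m, M m -> '[f, m] = 0) -> N f.
Proof. by move=> Hf fM; exact: ominusK fM. Qed.

Lemma wandering_shifts n w w' : n != 0 -> W w -> W w' -> '[T n w, w'] = 0.
Proof.
have pos k v v' : W v -> W v' -> '[T (Posz k.+1) v, v'] = 0.
  move=> [Mv _] [_ v'P]; apply: inner_eq0C; apply: v'P.
  by rewrite -addn1 addnC PoszD TT; exists (T k%:Z v) => //; exact: M_shiftn.
case: n => [[|k]//|k] _ Ww Ww'; first exact: pos.
by rewrite NegzE Tadj opprK; apply: inner_eq0C; exact: pos.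
Qed.

Lemma adjoint_compression f g : N f -> N g -> '[A f, g] = '[f, B g].
Proof.
move=> Nf Ng; rewrite ortho_proj_inner//.
by rewrite (adjoint_shiftP _).2//; exact: NH.
Qed.

Let compression_adjoint f g : N f -> N g -> '[f, A g] = '[B f, g].
Proof.
by move=> Nf Ng; rewrite inner_conj adjoint_compression// -inner_conj.
Qed.

Let N_compression f : N (A f).
Proof. by case: (ortho_projP cV (T 1 f) sN). Qed.

Lemma inner_compression_iter k f g : N f -> N g -> '[f, iter k A g] = '[iter k B f, g].
Proof.
move=> + Ng; elim: k f => [//|k IH] f Nf.
rewrite iterS compression_adjoint//; last by case: k {IH} => [//|k]; exact: N_compression.
by rewrite IH ?iterSr//; exact: NB.
Qed.

Let perp_split A' (J : choiceType) (x : J -> V) g : closed_subspace A' ->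
  WC `<=` A' -> orthonormal_basis (ominus A' WC) x ->
  (forall j, '[g, x j] = 0) -> (forall c, WC c -> '[g, c] = 0) ->
  forall c, A' c -> '[g, c] = 0.
Proof.
move=> sA' WCA ox gx gWC c Ac; have [p WCp Ap] := ominus_split cV sA' sWC WCA Ac.
rewrite -[c](subrK p) innerDr (gWC p)// addr0.
exact: orthonormal_basis_perp ox gx _ Ap.
Qed.

Section bases.
Variables (J : choiceType) (e E : J -> V).
Hypothesis oe : orthonormal_basis K1 e.
Hypothesis oE : orthonormal_basis W1 E.
Hypothesis Wtot : forall g, (forall n w, W w -> '[g, T n w] = 0) -> g = 0.
Hypothesis cJ : countable [set: J].

Let K1e j : K1 (e j). Proof. exact: orthonormal_basis_mem oe. Qed.
Let W1E j : W1 (E j). Proof. exact: orthonormal_basis_mem oE. Qed.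
Let Ce j : C (e j). Proof. by case: (K1e j). Qed.
Let WE j : W (E j). Proof. by case: (W1E j). Qed.
Let HW w : W w -> H w. Proof. by case=> -[]. Qed.
Let He j : H (e j). Proof. exact: hardy_of_sub. Qed.
Let HE j : H (E j). Proof. exact: HW. Qed.

Let NW f k w : N f -> W w -> '[f, T (Posz k) w] = 0.
Proof.
move=> Nf [Mw _]; apply: inner_eq0C; have [_] := M_shiftn k Mw.
exact.
Qed.

(** [f] is orthogonal to [T n C] for [n < 0], as a member of [H], and to
    [T k WC] for [k >= 0], which lies in [M]; what remains of the translates of
    [C], which span [V], is covered by the [T k (e j)]. *)
Lemma parseval_K1 f : N f ->
  \esum_(p in [set: J * nat]) (csq '[f, T (Posz p.2) (e p.1)])%:E = (sqnorm f)%:E.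
Proof.
move=> Nf; apply: (parseval_of_perp cV).
  apply: (@orthonormal_shifts K1 _ e Posz) => //; last by move=> m n [].
  by move=> n w w' n0 [Cw _] [Cw' _]; exact: Cwand.
move=> g gx gy; apply: Ctot => -[k|k] c Cc; last first.
  rewrite gy; first exact: (NH Nf).
  by move=> [j l] /=; rewrite inner_shift Cwand.
rewrite inner_shiftr; apply: (perp_split sC _ oe) Cc; first exact: subIsetr.
  by move=> j; rewrite -inner_shiftr; exact: (gx (j, k)).
move=> c' [Wc' Cc']; rewrite -inner_shiftr gy ?NW// => -[j l] /=.
rewrite inner_shift; have [->|kl] := eqVneq k l; last first.
  by rewrite Cwand// subr_eq0 eqz_nat.
by rewrite subrr T0; apply: inner_eq0C; apply: (K1e j).2.
Qed.

(** [f] is orthogonal to [T k W] for [k >= 0], which lies in [M], and to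
    [T (- k.+1) WC], because [T k.+1 f] has no constant term; what remains of
    the translates of [W], which span [V], is covered by the
    [T (- k.+1) (E j)]. *)
Lemma parseval_W1 f : N f ->
  \esum_(p in [set: J * nat]) (csq '[f, T (- (Posz p.2.+1)) (E p.1)])%:E =
  (sqnorm f)%:E.
Proof.
move=> Nf; apply: (parseval_of_perp cV).
  apply: (@orthonormal_shifts W1 _ E (fun k => - (Posz k.+1))) => //.
    by move=> n w w' n0 [Ww _] [Ww' _]; exact: wandering_shifts.
  by move=> m n /oppr_inj [].
move=> g gx gy; apply: Wtot => -[k|k] w Ww.
  rewrite gy ?NW// => -[j l] /=; rewrite inner_shift wandering_shifts//.
  by rewrite opprK -PoszD addnS.
rewrite NegzE inner_shiftr; apply: (perp_split sW _ oE) Ww; first exact: subIsetl.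
  by move=> j; rewrite -inner_shiftr; exact: (gx (j, k)).
move=> c' [Wc' Cc']; rewrite -inner_shiftr gy.
  rewrite inner_shiftr opprK -addn1 addnC PoszD TT inner_shift_cst//.
  elim: k {gx} => [|k IH]; first by rewrite T0; exact: NH.
  by rewrite -addn1 addnC PoszD TT; exact: hardy_of_shift.
move=> [j l] /=; rewrite inner_shift; have [->|kl] := eqVneq k l; last first.
  rewrite wandering_shifts// subr_eq0 (inj_eq oppr_inj) eqz_nat eqSS.
  exact: kl.
by rewrite subrr T0; apply: inner_eq0C; apply: (W1E j).2.
Qed.

(** A combination [k] of the [e j] with zero projection is a constant in [M],
    so it lies in [WC], to which it is also orthogonal. *)
Lemma lin_indep_proj : lin_indep (fun j => ortho_proj N (e j)).
Proof.
move=> s c us s0 i si; pose k := \sum_(j <- s) c j *: e j.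
have Ck : C k by apply: (subspace_sum sC) => j; exact: subspaceZ.
have kN g : N g -> '[k, g] = 0.
  move=> Ng; rewrite -[RHS](inner0l g) -s0 !inner_suml.
  by apply: eq_bigr => j _; rewrite !innerZl ortho_proj_inner.
have K1k : K1 k by apply: (subspace_sum sK1) => j; exact: subspaceZ.
have WCk : WC k.
  split=> //; split; first by split=> //; exact: hardy_of_sub.
  by move=> _ [h [Hh _] <-]; apply: inner_eq0C; exact: inner_shift_cst.
have k0 : k = 0 by apply: inner_self_eq0; exact: (K1k.2 _ WCk).
have : '[k, e i] = 0 by rewrite k0 inner0l.
rewrite inner_suml (bigD1_seq i)//= innerZl oe.1 eqxx mulr1 big1 ?addr0// => j ji.
by rewrite innerZl oe.1 (negbTE ji) mulr0.
Qed.

(** A combination [k] of the [E j] killed by [B] is a constant, so it lies in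
    [WC], to which it is also orthogonal. *)
Lemma lin_indep_adjoint : lin_indep (fun j => B (E j)).
Proof.
move=> s c us s0 i si; pose k := \sum_(j <- s) c j *: E j.
have W1k : W1 k by apply: (subspace_sum sW1) => j; exact: subspaceZ.
have Hk : H k by apply: HW; case: W1k.
have Ck : C k.
  apply: hardy_of_constants => // h Hh.
  rewrite -[RHS](inner0l h) -s0 !inner_suml; apply: eq_bigr => j _.
  by rewrite !innerZl inner_conj (adjoint_shiftP _).2// -inner_conj.
have WCk : WC k by split=> //; case: W1k.
have k0 : k = 0 by apply: inner_self_eq0; exact: (W1k.2 _ WCk).
have : '[k, E i] = 0 by rewrite k0 inner0l.
rewrite inner_suml (bigD1_seq i)//= innerZl oE.1 eqxx mulr1 big1 ?addr0// => j ji.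
by rewrite innerZl oE.1 (negbTE ji) mulr0.
Qed.

Let N_adjoint_E j : N (B (E j)).
Proof.
apply: perp_M => [|w Mw]; first by case: (adjoint_shiftP (E j)).
apply: inner_eq0C; rewrite -(adjoint_shiftP _).2; last by case: Mw.
by apply: inner_eq0C; have [_] := WE j; apply; exists w.
Qed.

(** For [f] in [N] the inner product of [f] with [A^k] of the projection of
    [e j] is ['[f, T k (e j)]], so [parseval_K1] is the Parseval identity. *)
Lemma compression_optimal :
  optimal_parseval_generators N A (fun j => ortho_proj N (e j)).
Proof.
have lv := lin_indep_proj.
have Nv j : N (ortho_proj N (e j)) by case: (ortho_projP cV (e j) sN).
apply: (optimal_lin_indep sN NB compression_adjoint) => //.
split=> //; first exact: lin_indep_neq0.
split.
- by rewrite -setXTT; exact: countableX cJ (countableP _).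
- by move=> [j [|k]] //=; exact: N_compression.
move=> f Nf; rewrite -(parseval_K1 Nf); apply: eq_esum => -[j k] _.
rewrite Re_sqr_norm /= inner_compression_iter// inner_conj ortho_proj_inner//.
  by rewrite -inner_conj inner_adjoint_iter//; exact: NH.
by elim: k => [|k IH] //=; exact: NB.
Qed.

(** The inner product of [f] with [B^k.+1 (E j)] is ['[f, T (- k.+1) (E j)]], so
    [parseval_W1] is the Parseval identity. *)
Lemma adjoint_optimal : optimal_parseval_generators N B (fun j => B (E j)).
Proof.
have lv := lin_indep_adjoint.
apply: (optimal_lin_indep sN (fun f _ => N_compression f)) => //.
  by move=> f g Nf Ng; rewrite adjoint_compression.
split=> //; first exact: lin_indep_neq0.
split.
- by rewrite -setXTT; exact: countableX cJ (countableP _).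
- by move=> [j k]; elim: k => [|k IH] //=; exact: NB.
move=> f Nf; rewrite -(parseval_W1 Nf); apply: eq_esum => -[j k] _.
rewrite Re_sqr_norm /= csq_innerC -iterSr inner_adjoint_iter//; last exact: NH.
by rewrite csq_innerC [in RHS]inner_shiftr opprK.
Qed.

End bases.
End model.
End bilateral_shift.

(** * The bilateral shift on the circle *)

Section circle_powers.
Context {R : realType}.
Local Notation mu := (@circle_measure R).
Local Notation leb := (@lebesgue_measure R).
Local Notation leb01 := (mrestr leb (measurable_itv `[0%R, 1%R])).

Lemma cis_expn (n : nat) (t : R) :
  val (cis t) ^+ n = (cos (2 * pi * t *+ n) +i* sin (2 * pi * t *+ n))%C.
Proof.
elim: n => [|n IH]; first by rewrite !mulr0n cos0 sin0.
rewrite exprS IH val_cis !mulrS cosD sinD; apply/eqP.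
by rewrite eq_complex/=; apply/andP; split; apply/eqP; ring.
Qed.

(** The pushforward along [cis], followed by the passage from the restricted
    Lebesgue measure to the integral over the interval. *)
Lemma integral_circle (f : circle R -> R) (M : R) : measurable_fun setT f ->
  (forall z, `|f z| <= M) ->
  \int[mu]_z f z = \int[leb]_(t in `[0, 1]) f (cis t).
Proof.
move=> mf fM; rewrite /Rintegral; congr fine.
have mfc : measurable_fun setT (f \o @cis R).
  by apply: measurableT_comp => //; exact: measurable_cis.
have fi : (leb01).-integrable setT (EFin \o (f \o @cis R)).
  apply: measurable_bounded_integrable => //.
    rewrite /= /mrestr setTI lebesgue_measure_itv/= lte01 oppr0 adde0.
    exact: ltry.
  by exists M; split=> [|y My x _ /=]; [exact: num_real|exact: le_trans (fM _) (ltW My)].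
have mEf : measurable_fun setT (EFin \o f) by exact/measurable_EFinP.
have := @integral_pushforward _ _ (measurableTypeR R) _ _ (@cis R) (@measurable_cis R) _ setT
  (EFin \o f) mEf fi measurableT.
rewrite preimage_setT => pf.
transitivity (\int[leb01]_t ((f \o @cis R) t)%:E)%E.
  rewrite -[RHS]pf; apply: eq_measure_integral; first exact: measurable_cis.
  by move=> mcis A mA _.
pose D : set (measurableTypeR R) := [set t | (0 <= t :> R) && (t <= 1)].
have DE : [set` `[0%R, 1%R]] = D by apply/seteqP; split=> t; rewrite /= in_itv.
have mD : measurable D by rewrite -DE; exact: measurable_itv.
have D0 : leb01 (~` D) = 0%E by rewrite /= /mrestr DE setICl measure0.
rewrite (@negligible_integral _ _ _ _ setT (~` D))//; last exact: measurableC.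
rewrite setTD setCK -DE; apply: eq_measure_integral => A mA AD.
by rewrite /= /mrestr setIidl.
Qed.

Lemma circle_angleE (n : nat) (t : R) : 2 * pi * t *+ n = (2 * pi *+ n) * t.
Proof. by rewrite [RHS]mulrnAl. Qed.

Lemma integral_cos_sin_period (n : nat) :
  (\int[leb]_(t in `[0, 1]) cos (2 * pi * t *+ n.+1) = 0) /\
  (\int[leb]_(t in `[0, 1]) sin (2 * pi * t *+ n.+1) = 0).
Proof.
pose a : R := 2 * pi *+ n.+1.
have a0 : a != 0 by rewrite mulrn_eq0/= mulf_eq0 pnatr_eq0/= gt_eqF// pi_gt0.
have period m : cos (2 * pi *+ m : R) = 1 /\ sin (2 * pi *+ m : R) = 0.
  elim: m => [|m [cm sm]]; first by rewrite cos0 sin0.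
  by rewrite mulrS cosD sinD cm sm mulr_natl cos2pi sin2pi !mulr0 !mulr1 subr0 addr0.
have [ca sa] : cos a = 1 /\ sin a = 0 by exact: period.
have dl (t : R) : is_derive t (1 : R) (fun t : R => a * t) a.
  by apply: is_derive_eq (is_deriveZ _ _) _; rewrite [_ *: _]mulr1.
have ds (t : R) : is_derive t (1 : R) (fun t => a^-1 * sin (a * t)) (cos (a * t)).
  have := is_deriveZ a^-1 (is_derive1_comp (is_derive_sin (a * t)) (dl t)).
  by move=> /is_derive_eq; apply; rewrite [_ *: _]mulrCA mulVf ?mulr1.
have dc (t : R) : is_derive t (1 : R) (fun t => - a^-1 * cos (a * t)) (sin (a * t)).
  have := is_deriveZ (- a^-1) (is_derive1_comp (is_derive_cos (a * t)) (dl t)).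
  by move=> /is_derive_eq; apply; rewrite [_ *: _]mulrA mulrNN mulrAC mulVf// mul1r.
have FTC (f F : R -> R) : (forall t : R, is_derive t (1 : R) F (f t)) -> continuous f ->
    \int[leb]_(t in `[0, 1]) f t = F 1 - F 0.
  move=> dF cf; rewrite /Rintegral.
  have cF : continuous F.
    by move=> t; apply: differentiable_continuous; apply/derivable1_diffP; case: (dF t).
  rewrite (@continuous_FTC2 _ f F 0 1)//.
  - exact: continuous_subspaceT.
  - split; [by move=> t _; case: (dF t)|exact/cvg_at_right_filter/cF|exact/cvg_at_left_filter/cF].
  - by move=> t _; rewrite derive1E; case: (dF t).
split; under eq_Rintegral do rewrite circle_angleE -/a.
  rewrite (FTC _ _ ds); first by rewrite mulr1 mulr0 sa sin0 subrr.
  by move=> t; apply: continuous_comp; [exact: mulrl_continuous|exact: continuous_cos].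
rewrite (FTC _ _ dc); first by rewrite mulr1 mulr0 ca cos0 subrr.
by move=> t; apply: continuous_comp; [exact: mulrl_continuous|exact: continuous_sin].
Qed.

End circle_powers.

Section vector_shift.
Context {R : realType} (K : sepHilbertType R).
Local Notation mu := (@circle_measure R).
Local Notation L := (L2T K).
Implicit Types (F G : L) (u v : K) (n : int).

(** The integrability of [z ^ n] for [n] of either sign is an instance of
    [cintegrable_zX]. *)
Lemma measurable_circle_expz n :
  measurable_fun setT (fun z : circle R => complex.Re (val z ^ n)) /\
  measurable_fun setT (fun z : circle R => complex.Im (val z ^ n)).
Proof.
have i1 : cintegrable mu (fun=> 1).
  by split; exact: finite_measure_integrable_cst.
have [/rintegrable_measurable + /rintegrable_measurable] := cintegrable_zX n i1.
by under eq_fun do rewrite mulr1; move=> mr; under eq_fun do rewrite mulr1.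
Qed.

Lemma norm_circle_expz n (z : circle R) : `|val z ^ n| = 1.
Proof.
case: n => n; first by rewrite -exprnP normrX (eqP (valP z)) expr1n.
by rewrite NegzE -exprnN normfV normrX (eqP (valP z)) expr1n invr1.
Qed.

Lemma circle_expz_inv n (z : circle R) : (val z ^ n)^-1 = (val z ^ n)^*%C.
Proof.
have nz : `|val z ^ n| == 1 by rewrite norm_circle_expz.
by have := circle_inv (exist (fun w : R[i] => `|w| == 1) _ nz : circle R).
Qed.

Lemma L2_pred_zpow n F :
  (fun z : circle R => val z ^ n *: L2_eval F z) \in L2_pred mu K.
Proof.
have /L2_predP[mF Foo] := L2_evalP F; apply/L2_predP; split.
  by have [mr mi] := measurable_circle_expz n; exact: borel_fun_complexZ.
under eq_integral => z _ do rewrite sqnormZ norm_circle_expz expr1n mul1r.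
exact: Foo.
Qed.

(** The bilateral shift and its iterates, as an action of the integers. *)
Definition zpow n F : L := mkL2 (L2_pred_zpow n F).

Lemma zpow_eval n F :
  {ae mu, forall z, L2_eval (zpow n F) z = val z ^ n *: L2_eval F z}.
Proof. exact: L2_eval_mkL2. Qed.

Lemma zpow0 F : zpow 0 F = F.
Proof.
apply: L2_eval_inj; apply: filterS (zpow_eval 0 F) => z ->.
by rewrite expr0z scale1r.
Qed.

Lemma zpowD m n F : zpow (m + n) F = zpow m (zpow n F).
Proof.
apply: L2_eval_inj.
apply: filterS3 (zpow_eval (m + n) F) (zpow_eval m (zpow n F)) (zpow_eval n F) => z -> -> ->.
by rewrite expfzDr ?circle_neq0// scalerA.
Qed.

Lemma shift_zpow : @Defs.shift R K = zpow 1.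
Proof.
apply/funext => F; apply: L2_eval_inj.
apply: filterS2 (L2_eval_mkL2 (L2_pred_shift F)) (zpow_eval 1 F) => z -> ->.
by rewrite expr1z.
Qed.

Lemma cintegrable_inner F G : cintegrable mu (fun z => '[L2_eval F z, L2_eval G z]).
Proof. by split; [exact: integrable_Re_inner|exact: integrable_Im_inner]. Qed.

Lemma ae_eq_Cintegral (f g : circle R -> R[i]) :
  cintegrable mu f -> measurable_fun setT (fun z => complex.Re (g z)) ->
  measurable_fun setT (fun z => complex.Im (g z)) ->
  {ae mu, forall z, f z = g z} -> Cintegral mu f = Cintegral mu g.
Proof.
move=> [fr fi] gr gi fg; rewrite /Cintegral /Rintegral; congr (fine _ +i* fine _)%C;
  apply: ae_eq_integral => //.
- exact: measurable_int fr.
- exact/measurable_EFinP.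
- by apply: filterS fg => z /= -> _.
- exact: measurable_int fi.
- exact/measurable_EFinP.
- by apply: filterS fg => z /= -> _.
Qed.

Lemma inner_zpow n F G :
  '[zpow n F, G] = Cintegral mu (fun z => val z ^ n * '[L2_eval F z, L2_eval G z]).
Proof.
rewrite L2_innerE.
have [mr mi] := cintegrable_zX n (cintegrable_inner F G).
apply: ae_eq_Cintegral; first exact: cintegrable_inner.
- exact: (rintegrable_measurable mr).
- exact: (rintegrable_measurable mi).
by apply: filterS (zpow_eval n F) => z ->; rewrite innerZl.
Qed.

Lemma inner_zpow_cst n F u :
  '[zpow n F, cstT u] = Cintegral mu (fun z => val z ^ n * '[L2_eval F z, u]).
Proof.
rewrite inner_zpow; have [mr mi] := cintegrable_zX n (cintegrable_inner F (cstT u)).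
have bF := borel_fun_L2_eval F.
have [er ei] := measurable_circle_expz n.
have ir : measurable_fun setT (fun z => complex.Re '[L2_eval F z, u]).
  by apply: borel_fun_Re_inner => //; exact: borel_fun_cst.
have ii : measurable_fun setT (fun z => complex.Im '[L2_eval F z, u]).
  by apply: borel_fun_Im_inner => //; exact: borel_fun_cst.
apply: ae_eq_Cintegral; first by split.
- rewrite (_ : (fun _ => _) = (fun z : circle R =>
    complex.Re (val z ^ n) * complex.Re '[L2_eval F z, u] -
    complex.Im (val z ^ n) * complex.Im '[L2_eval F z, u])).
    by apply: measurable_funB; exact: measurable_funM.
  by apply/funext => z; case: (val z ^ n) '[_, _] => ? ? [].
- rewrite (_ : (fun _ => _) = (fun z : circle R =>
    complex.Re (val z ^ n) * complex.Im '[L2_eval F z, u] +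
    complex.Im (val z ^ n) * complex.Re '[L2_eval F z, u])).
    by apply: measurable_funD; exact: measurable_funM.
  by apply/funext => z; case: (val z ^ n) '[_, _] => ? ? [].
by apply: filterS (L2_eval_mkL2 (L2_pred_cst u)) => z ->.
Qed.

Lemma zpow_adjoint n F G : '[zpow n F, G] = '[F, zpow (- n) G].
Proof.
rewrite [RHS]inner_conj !inner_zpow /Cintegral /=.
have cE (z : circle R) : val z ^ n * '[L2_eval F z, L2_eval G z] =
    (val z ^ (- n) * '[L2_eval G z, L2_eval F z])^*%C.
  rewrite rmorphM; congr (_ * _); last exact: inner_conj.
  by rewrite -invr_expz circle_expz_inv; exact: esym (conjcK _).
congr (_ +i* _)%C.
  by apply: eq_Rintegral => z _; rewrite cE; case: (_ * _).
have [_ i2] := cintegrable_zX (- n) (cintegrable_inner G F).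
rewrite -mulN1r -RintegralZl//.
by apply: eq_Rintegral => z _; rewrite cE mulN1r; case: (_ * _).
Qed.

Lemma cstT_eval u : {ae mu, forall z, L2_eval (cstT u) z = u}.
Proof. exact: L2_eval_mkL2. Qed.

Lemma cstT_comb (c : R[i]) u v : cstT (c *: u + v) = c *: cstT u + cstT v.
Proof.
apply: L2_eval_inj.
apply: filterS3 (cstT_eval (c *: u + v)) (filterI (cstT_eval u) (cstT_eval v))
  (filterI (L2_evalD (c *: cstT u) (cstT v)) (L2_evalZ c (cstT u))) => z -> [Eu Ev] [-> ->].
by rewrite Eu Ev.
Qed.

Lemma cstTB u v : cstT (u - v) = cstT u - cstT v.
Proof. by rewrite addrC -scaleN1r cstT_comb scaleN1r addrC. Qed.

Lemma sqnorm_cstT u : sqnorm (cstT u) = sqnorm u.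
Proof.
apply: EFin_inj; rewrite L2_sqnormE.
transitivity (\int[mu]_z (sqnorm u)%:E)%E.
  apply: ae_eq_integral => //.
  - by apply/measurable_EFinP; exact: (borel_fun_sqnorm (borel_fun_L2_eval _)).
  - by apply: filterS (cstT_eval u) => z -> _.
by rewrite integral_cst// [X in (_ * X)%E]circle_measureT mule1.
Qed.

Lemma constants_subspace : closed_subspace (constants K).
Proof.
split.
  apply: complete_closed => f fC /=.
  have /choice[k kP] : forall n : nat, exists u, cstT u = f n.
    by move=> n; case: (fC n) => u; exists u.
  move=> cf; have ck : cauchy_sqnorm k.
    move=> e /cf[N NP]; exists N => m n Nm Nn.
    by rewrite -sqnorm_cstT cstTB !kP NP.
  have [l [_ kl]] := sepHilbert_complete ck.
  exists (cstT l); first by exists l.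
  move=> e /kl[N NP]; exists N => n Nn.
  by rewrite -kP -cstTB sqnorm_cstT NP.
split.
  by rewrite inE; exists 0 => //; have := cstTB 0 0; rewrite !subrr.
move=> c f g; rewrite !inE => -[u _ <-] [v _ <-].
by exists (c *: u + v) => //; rewrite cstT_comb.
Qed.

Lemma Cintegral_expn (n : nat) : Cintegral mu (fun z => val z ^+ n.+1) = 0.
Proof.
have [mr mi] := measurable_circle_expz (Posz n.+1).
have [c0 s0] := @integral_cos_sin_period R n.
have b1 (z : circle R) :
    `|complex.Re (val z ^+ n.+1)| <= 1 /\ `|complex.Im (val z ^+ n.+1)| <= 1.
  have nz : `|val z ^+ n.+1| == 1 by rewrite exprnP norm_circle_expz.
  pose w : circle R := exist (fun w : R[i] => `|w| == 1) _ nz.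
  by have := circle_Re_le1 w; have := circle_Im_le1 w.
rewrite /Cintegral (integral_circle mr (fun z => (b1 z).1)).
rewrite (integral_circle mi (fun z => (b1 z).2)).
apply/eqP; rewrite eq_complex/=; apply/andP; split; apply/eqP.
  by rewrite -[RHS]c0; apply: eq_Rintegral => t _; rewrite -exprnP cis_expn.
by rewrite -[RHS]s0; apply: eq_Rintegral => t _; rewrite -exprnP cis_expn.
Qed.

Lemma constants_wandering n F G : n != 0 -> constants K F -> constants K G ->
  '[zpow n F, G] = 0.
Proof.
have pos (k : nat) u v : '[zpow k.+1 (cstT u), cstT v] = 0.
  have c1 : cintegrable mu (fun=> 1) by split; exact: finite_measure_integrable_cst.
  have iz : cintegrable mu (fun z => val z ^+ k.+1).
    have := cintegrable_zX k.+1 c1.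
    by rewrite (_ : (fun _ => _) = (fun z => val z ^+ k.+1))//; apply/funext => z; rewrite mulr1.
  have [jr ji] := cintegrableZ '[u, v] iz.
  rewrite inner_zpow (@ae_eq_Cintegral _ (fun z => '[u, v] * val z ^+ k.+1)).
  - by rewrite CintegralZ// Cintegral_expn mulr0.
  - exact/cintegrable_zX/cintegrable_inner.
  - exact: rintegrable_measurable jr.
  - exact: rintegrable_measurable ji.
  - by apply: filterS2 (cstT_eval u) (cstT_eval v) => z -> ->; rewrite mulrC.
case: n => [[|k]//|k] _ [u _ <-] [v _ <-]; first exact: pos.
by rewrite NegzE zpow_adjoint opprK; apply: inner_eq0C; exact: pos.
Qed.

Lemma ae_forall_countable (I : choiceType) (P : I -> circle R -> Prop) :
  countable [set: I] -> (forall i, {ae mu, forall z, P i z}) ->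
  {ae mu, forall z, forall i, P i z}.
Proof.
move=> /countable_injP[h hinj] Pae.
have : {ae mu, forall z, forall k i, h i = k -> P i z}.
  apply: ae_foralln => k; have [[i hik]|nk] := pselect (exists i, h i = k).
    apply: filterS (Pae i) => z Piz j hjk.
    suff -> : j = i by [].
    by apply: hinj; rewrite ?in_setT// hik.
  by apply: aeW => z i hik; exfalso; apply: nk; exists i.
by apply: filterS => z Pz i; exact: Pz (h i) i erefl.
Qed.

(** The inner products are the Fourier coefficients of the scalar function
    [z |-> '[F z, x i z]], which therefore vanishes almost everywhere. *)
Lemma ae_perp_zpow (I : choiceType) (x : I -> L) F : countable [set: I] ->
  (forall n i, '[F, zpow n (x i)] = 0) ->
  {ae mu, forall z, forall i, '[L2_eval F z, L2_eval (x i) z] = 0}.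
Proof.
move=> cI Fx; apply: ae_forall_countable => // i; apply: moments0_ae0.
split; first exact: cintegrable_inner.
by move=> n; rewrite -inner_zpow zpow_adjoint Fx.
Qed.

(** At almost every point [F] is orthogonal to a family that spans [K]. Applied
    to the constants this says that their translates span the whole space;
    applied to a basis of the wandering subspace it is what full range gives. *)
Lemma total_zpow (I : choiceType) (x : I -> L) F : countable [set: I] ->
  {ae mu, forall z, closed_span (fun i => L2_eval (x i) z) = [set: K]} ->
  (forall n i, '[F, zpow n (x i)] = 0) -> F = 0.
Proof.
move=> cI full Fx; apply: L2_eval_inj.
apply: filterS3 full (ae_perp_zpow cI Fx) (@L2_eval0 _ _ _ mu K) => z fz Fz ->.
apply: inner_self_eq0; apply: inner_eq0C.
have : closed_span (fun i => L2_eval (x i) z) (L2_eval F z) by rewrite fz.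
by apply: (closed_span_sub (closed_perp _)) => i /=; exact: inner_eq0C.
Qed.

Lemma closed_span_dense_seq : exists s : nat -> K, closed_span s = [set: K].
Proof.
have [s sP] := exists_dense_seq K.
exists s; apply/seteqP; split=> // y _; apply/closureP => e /(sP y)[k yk].
by exists (s k) => //; exists [:: k], (fun=> 1); rewrite big_seq1 scale1r.
Qed.

Lemma total_constants (s : nat -> K) F : closed_span s = [set: K] ->
  (forall n k, '[F, zpow n (cstT (s k))] = 0) -> F = 0.
Proof.
move=> sK; apply: total_zpow; first exact: countableP.
have ck : {ae mu, forall z, forall k, L2_eval (cstT (s k)) z = s k}.
  by apply: ae_foralln => k; exact: cstT_eval.
by apply: filterS ck => z ck; rewrite -sK; congr closed_span; apply/funext.
Qed.

Lemma hardyE : hardy K = hardy_of zpow (constants K).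
Proof.
apply/seteqP; split=> F HF n n0.
  move=> _ [u _ <-]; rewrite -[n]opprK -zpow_adjoint inner_zpow_cst -(HF _ n0).
  by rewrite inner0l.
move=> u; rewrite -inner_zpow_cst zpow_adjoint opprK inner0l.
by rewrite HF//; exists u.
Qed.

End vector_shift.

(** * Optimal Parseval frames of a model space *)

Theorem corollary6p6 (R : realType) (K : sepHilbertType R)
    (N : set (L2T K)) (J : choiceType) (E e : J -> L2T K) :
  let M := ominus (hardy K) N in
  let W := wandering M in
  let W1 := ominus W (W `&` constants K) in
  let K1 := ominus (constants K) (W `&` constants K) in
  model_space N ->
  full_range M ->
  orthonormal_basis W1 E ->
  orthonormal_basis K1 e ->
  optimal_parseval_generators N (compression N)
    (fun j => ortho_proj N (e j)) /\
  optimal_parseval_generators N (@backward_shift R K)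
    (fun j => backward_shift (E j)).
Proof.
move=> M W W1 K1 [NH sN NB] [I [F [oF fullF]]] oE oe.
have cV : complete_set [set: L2T K] by exact: L2_complete.
have [s sK] := closed_span_dense_seq K.
have Dtot g : (forall m, '[g, zpow m.1 (cstT (s m.2))] = 0) -> g = 0.
  by move=> gD; apply: (total_constants sK) => n k; exact: (gD (n, k)).
(* The vectors [z ^ n s_k] form a total sequence, so orthonormal families are
   countable. *)
have countable_orthonormal (I' : choiceType) (x : I' -> L2T K) A :
    orthonormal_basis A x -> countable [set: I'].
  case=> ox _.
  pose D k := if unpickle k is Some p then zpow p.1 (cstT (s p.2)) else 0.
  apply: (orthonormal_countable (D := D) ox) => g gD; apply: Dtot => p.
  by have := gD (pickle p); rewrite /D pickleK.
have sC := constants_subspace K.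
have Ctot g : (forall n c, constants K c -> '[g, zpow n c] = 0) -> g = 0.
  by move=> gC; apply: Dtot => p; apply: gC; exists (s p.2).
have Wtot g : (forall n w, W w -> '[g, zpow n w] = 0) -> g = 0.
  move=> gW; apply: (total_zpow (countable_orthonormal _ _ _ oF) fullF) => n i.
  by apply: gW; exact: orthonormal_basis_mem oF.
have cJ := countable_orthonormal _ _ _ oe.
have BE : @backward_shift R K = adjoint_on (hardy_of (@zpow R K) (constants K)) (zpow 1).
  by rewrite /backward_shift shift_zpow hardyE.
have AE : compression N = (fun f => ortho_proj N (zpow 1 f)).
  by apply/funext => f; rewrite /compression shift_zpow.
rewrite BE in NB *; rewrite AE.
rewrite /W1 /K1 /W /wandering /M shift_zpow hardyE in NH oE oe Wtot.
split.
  exact: (@compression_optimal R (L2T K) cV (@zpow R K) (@zpow0 R K) (@zpowD R K)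
    (@zpow_adjoint R K) (constants K) sC (@constants_wandering R K) Ctot
    N NH sN NB J e oe cJ).
exact: (@adjoint_optimal R (L2T K) cV (@zpow R K) (@zpow0 R K) (@zpowD R K)
  (@zpow_adjoint R K) (constants K) sC (@constants_wandering R K) Ctot
  N NH sN NB J E oE Wtot cJ).
Qed.
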